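(* Let $\omega \ge 1$ be a fixed integer. There exists a polynomial-time approximation algorithm for the maximum revenue (road pricing) problem restricted to instances $(G,B)$ in which $G$ is a complete $m \times \omega$ grid ($m$ rows, width $\omega$, with $m$ varying as part of the instance), with approximation ratio $O(\log m)$. That is, for each fixed $\omega$ there is an algorithm, running in time polynomial in the size of the instance, which given $(G,B)$ outputs a pricing $p : E(G) \to \mathbb{R}_{\ge 0}$ whose revenue is at least $\mathrm{OPT}(G,B)/O(\log m)$, where the constant hidden in the $O(\cdot)$ may depend on $\omega$ only.
   Context: An instance of the problem consists of an undirected graph $G=(V,E)$ and a finite multiset $B$ of drivers. Each driver is a tuple $(u,v,b)$ consisting of two nodes $u,v\in V$ and a non-negative real number $b$ (the budget). A pricing is a function $p:E\to\mathbb{R}_{\ge 0}$. The cost of a path is the sum of the prices of its edges. Under $p$, the revenue generated by driver $(u,v,b)$ is the cost of a lowest-cost $u$-$v$ path in $G$ if this cost is at most $b$, and $0$ otherwise. The revenue of $p$ is the sum over all drivers in $B$ (with multiplicity) of the revenue they generate, and $\mathrm{OPT}(G,B)$ is the maximum revenue over all pricings. A complete $m\times\omega$ grid has $m$ rows of $\omega$ vertices each, with edges exactly between horizontally or vertically adjacent vertices. The width $\omega$ is treated as a constant; running time is measured in the size of the instance. *)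

(* Defs.v *)
From mathcomp Require Import all_boot all_order all_algebra.
From mathcomp Require Import boolp classical_sets reals ereal exp.
Set Implicit Arguments.
Unset Strict Implicit.
Unset Printing Implicit Defensive.
Import Order.TTheory GRing.Theory Num.Theory.
Local Open Scope ring_scope.

Record sgraph := SGraph {
  vertex :> finType;
  adj : rel vertex;
  adj_sym : symmetric adj;
  adj_irr : irreflexive adj }.

Record driver (R : realType) (G : sgraph) := Driver {
  source : G;
  target : G;
  budget : R;
  budget_ge0 : 0 <= budget }.

(* The edge joining x and y is the set [set x; y]; the values of a pricing on
   sets of vertices that are not edges are never used. *)
Record pricing (R : realType) (G : sgraph) := Pricing {
  price :> {set G} -> R;
  price_ge0 : forall x y : G, adj x y -> 0 <= price [set x; y] }.

Fixpoint path_cost (R : realType) (G : sgraph) (p : pricing R G) (x : G)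
    (s : seq G) : R :=
  if s is y :: s' then p [set x; y] + path_cost p y s' else 0.

Definition is_upath (G : sgraph) (u v : G) (s : seq G) : bool :=
  [&& path (@adj G) u s, uniq (u :: s) & last u s == v].

(* Simple paths are finitely many, so the infimum is attained when u and v are
   connected; it is +oo otherwise. *)
Definition lowest_cost (R : realType) (G : sgraph) (p : pricing R G)
    (u v : G) : \bar R :=
  ereal_inf [set (path_cost p u s)%:E | s in [set s | is_upath u v s]]%classic.

Definition driver_revenue (R : realType) (G : sgraph) (p : pricing R G)
    (d : driver R G) : R :=
  let c := lowest_cost p (source d) (target d) in
  if (c <= (budget d)%:E)%E then fine c else 0.

(* The multiset of drivers is a list, with repetitions. *)
Definition revenue (R : realType) (G : sgraph) (p : pricing R G)
    (B : seq (driver R G)) : R :=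
  \sum_(d <- B) driver_revenue p d.

(* The revenues form a nonempty set bounded by the sum of all budgets. *)
Definition OPT (R : realType) (G : sgraph) (B : seq (driver R G)) : R :=
  sup [set revenue p B | p in [set: pricing R G]]%classic.

(* y is the right or the lower neighbour of x = (row, column). *)
Definition grid_next m w (x y : 'I_m * 'I_w) : bool :=
  ((y.1 == x.1) && (y.2 == x.2.+1 :> nat))
  || ((y.1 == x.1.+1 :> nat) && (y.2 == x.2)).

Definition grid_adj m w : rel ('I_m * 'I_w) :=
  fun x y => grid_next x y || grid_next y x.

Lemma grid_adj_sym m w : symmetric (@grid_adj m w).
Proof. by move=> x y; rewrite /grid_adj orbC. Qed.

Lemma grid_adj_irr m w : irreflexive (@grid_adj m w).
Proof.
by move=> x; rewrite /grid_adj /grid_next !eqxx /= andbT !(ltn_eqF (ltnSn _)).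
Qed.

Definition grid (m w : nat) : sgraph :=
  SGraph (@grid_adj_sym m w) (@grid_adj_irr m w).

Definition grid_vertices m w : seq (grid m w) :=
  [seq (i, j) | i <- enum 'I_m, j <- enum 'I_w].

Definition grid_edges m w : seq (grid m w * grid m w) :=
  [seq xy <- [seq (x, y) | x <- grid_vertices m w, y <- grid_vertices m w]
     | grid_next xy.1 xy.2].

(* Jones's WHILE language over binary trees, whose leaves may also carry real
   numbers.  Every elementary operation has unit cost: a tree is a pointer to a
   cell, so that pairing, projecting and copying take constant time, and trees
   cannot be compared as a whole.  The operations on reals are the linear ones
   (addition, subtraction, scaling by a rational constant of the program,
   comparison); there is no multiplication of two reals and no rounding.  Hence
   after t steps every real held by a program is an affine combination of the
   input reals with rational coefficients of bit size O(t), and on rational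
   inputs a polynomial number of steps is polynomial time on a Turing
   machine. *)
Inductive val (R : Type) :=
  | VNil
  | VReal of R
  | VPair of val R & val R.
Arguments VNil {R}.

Inductive expr :=
  | EVar of nat
  | ENil
  | EPair of expr & expr
  | EFst of expr
  | ESnd of expr
  | EReal of rat
  | EAdd of expr & expr
  | ESub of expr & expr
  | EScale of rat & expr
  | ELe of expr & expr.

Inductive cmd :=
  | CSkip
  | CAssign of nat & expr
  | CSeq of cmd & cmd
  | CIf of expr & cmd & cmd
  | CWhile of expr & cmd.

Definition store (R : Type) := nat -> val R.

Definition update (R : Type) (s : store R) (x : nat) (v : val R) : store R :=
  fun y => if y == x then v else s y.

(* Truth values: VNil is false, anything else is true.  Operations applied to
   arguments of the wrong shape return VNil. *)
Definition truth (R : Type) (v : val R) : bool :=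
  if v is VNil then false else true.

Fixpoint eval (R : realType) (s : store R) (e : expr) : val R :=
  match e with
  | EVar x => s x
  | ENil => VNil
  | EPair e1 e2 => VPair (eval s e1) (eval s e2)
  | EFst e1 => if eval s e1 is VPair v _ then v else VNil
  | ESnd e1 => if eval s e1 is VPair _ v then v else VNil
  | EReal q => VReal (ratr q)
  | EAdd e1 e2 =>
      match eval s e1, eval s e2 with
      | VReal x, VReal y => VReal (x + y)
      | _, _ => VNil
      end
  | ESub e1 e2 =>
      match eval s e1, eval s e2 with
      | VReal x, VReal y => VReal (x - y)
      | _, _ => VNil
      end
  | EScale q e1 => if eval s e1 is VReal x then VReal (ratr q * x) else VNil
  | ELe e1 e2 =>
      match eval s e1, eval s e2 with
      | VReal x, VReal y => if x <= y then VPair VNil VNil else VNil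
      | _, _ => VNil
      end
  end.

Fixpoint expr_size (e : expr) : nat :=
  match e with
  | EVar _ | ENil | EReal _ => 1
  | EFst e1 | ESnd e1 | EScale _ e1 => (expr_size e1).+1
  | EPair e1 e2 | EAdd e1 e2 | ESub e1 e2 | ELe e1 e2 =>
      (expr_size e1 + expr_size e2).+1
  end.

(* exec c s t s': from the store s, the command c halts in the store s' after
   t elementary steps. *)
Inductive exec (R : realType) : cmd -> store R -> nat -> store R -> Prop :=
  | ExecSkip s : exec CSkip s 1 s
  | ExecAssign s x e :
      exec (CAssign x e) s (expr_size e).+1 (update s x (eval s e))
  | ExecSeq s1 s2 s3 c1 c2 t1 t2 :
      exec c1 s1 t1 s2 -> exec c2 s2 t2 s3 ->
      exec (CSeq c1 c2) s1 (t1 + t2) s3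
  | ExecIf s s' e c1 c2 t :
      exec (if truth (eval s e) then c1 else c2) s t s' ->
      exec (CIf e c1 c2) s (expr_size e + t).+1 s'
  | ExecWhileF s e c :
      ~~ truth (eval s e) -> exec (CWhile e c) s (expr_size e).+1 s
  | ExecWhileT s1 s2 s3 e c t1 t2 :
      truth (eval s1 e) -> exec c s1 t1 s2 -> exec (CWhile e c) s2 t2 s3 ->
      exec (CWhile e c) s1 (expr_size e + t1 + t2).+1 s3.

(* The input is read from, and the output left in, variable 0; all the other
   variables are initially VNil. *)
Definition runs (R : realType) (c : cmd) (input : val R) (t : nat)
    (output : val R) : Prop :=
  exists2 s : store R, exec c (update (fun=> VNil) 0 input) t s & s 0 = output.

Fixpoint val_size (R : Type) (v : val R) : nat :=
  if v is VPair v1 v2 then (val_size v1 + val_size v2).+1 else 1.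

Definition enc_seq (R : Type) (s : seq (val R)) : val R :=
  foldr (@VPair R) VNil s.

(* Numbers are in unary: the m rows of the grid contribute to the size of an
   instance, as they do when its vertices are listed. *)
Definition enc_nat (R : Type) (n : nat) : val R := enc_seq (nseq n VNil).

Definition enc_vertex (R : Type) m w (x : grid m w) : val R :=
  VPair (enc_nat R x.1) (enc_nat R x.2).

Definition enc_driver (R : realType) m w (d : driver R (grid m w)) : val R :=
  VPair (VPair (enc_vertex R (source d)) (enc_vertex R (target d)))
        (VReal (budget d)).

Definition enc_instance (R : realType) m w (B : seq (driver R (grid m w))) :
    val R :=
  VPair (enc_nat R m) (enc_seq [seq enc_driver d | d <- B]).

Definition enc_pricing (R : realType) m w (p : pricing R (grid m w)) : val R :=
  enc_seq [seq VPair (VPair (enc_vertex R xy.1) (enc_vertex R xy.2))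
                     (VReal (p [set xy.1; xy.2]))
          | xy <- grid_edges m w].

(* Main.v *)
(* Fix an edge pricing p with its distance d.  Two rows i < i' have a unique
   scale l at which they lie in the two halves of a block of 2^(l+1) rows, and a
   shortest path from u in row i to v in row i' crosses the first row of the
   upper half, say at z.  Then d(u, v) = d(u, z) + d(z, v), so that up to the
   choice of l, of one of the two halves and of the column of z, which costs a
   factor O(log m), the revenue is a sum of functions of a single endpoint.  Two
   vertices of the same row are even simpler, with z = v.
   Such functions can be sold.  Choose f on the chosen half of the blocks, in one
   column c, extend it by 0 to F, and give the edge xy the price |F x - F y|.
   The price of any path is at least the difference of F between its endpoints.
   If there are at least two columns, a driver leaves column c at the price f u
   and continues for free, so f can be arbitrary.  If there is only one column, f
   has to increase away from the separating row, as distances do, and the price of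
   the path telescopes.  Either way the best f takes its values among the budgets
   and is found by dynamic programming over the rows.
   The dynamic program is a nest of folds over lists of polynomial length, hence
   takes polynomial time. *)
Require Import Defs.
From mathcomp Require Import all_boot all_order all_algebra.
From mathcomp Require Import boolp classical_sets reals ereal exp.
From mathcomp Require Import zify lra.
Set Implicit Arguments.
Unset Strict Implicit.
Unset Printing Implicit Defensive.
Import Order.TTheory GRing.Theory Num.Theory.
Local Open Scope ring_scope.

(** * A first-order language of folds, compiled to WHILE programs *)

Local Notation tree := Defs.val.
Local Notation teval := Defs.eval.

(** Point-free programs whose only iteration is a fold, so that running time depends on list lengths
    alone. [FC g f] applies [f] first; in [FL l i s] the list and the initial accumulator come from
    [l] and [i], and the step [s] also sees the argument of the fold. *)
Inductive fn :=
  | FE of expr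
  | FC of fn & fn
  | FP of fn & fn
  | FI of fn & fn & fn
  | FL of fn & fn & fn.

(* As for EFst and ESnd in a while loop, a real counts as the list [:: VNil]. *)
Fixpoint vlist (R : Type) (v : tree R) : seq (tree R) :=
  match v with
  | VNil => [::]
  | VReal _ => [:: VNil]
  | VPair h t => h :: vlist t
  end.

Fixpoint run (R : realType) (f : fn) (v : tree R) : tree R :=
  match f with
  | FE e => teval (fun=> v) e
  | FC g f => run g (run f v)
  | FP f g => VPair (run f v) (run g v)
  | FI c f g => if truth (run c v) then run f v else run g v
  | FL l i s => foldl (fun acc h => run s (VPair h (VPair acc v)))
                  (run i v) (vlist (run l v))
  end.

Fixpoint all_steps (T A : Type) (P : A -> T -> Prop) (g : A -> T -> A) (a : A)
    (s : seq T) : Prop :=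
  if s is h :: s' then P a h /\ all_steps P g (g a h) s' else True.

(** [N] bounds the length of every list folded over during the run, which is all that the time bound
    needs. *)
Fixpoint safe (R : realType) (N : nat) (f : fn) (v : tree R) : Prop :=
  match f with
  | FE _ => True
  | FC g f => safe N f v /\ safe N g (run f v)
  | FP f g => safe N f v /\ safe N g v
  | FI c f g => safe N c v /\ if truth (run c v) then safe N f v else safe N g v
  | FL l i s =>
      [/\ safe N l v, safe N i v, (size (vlist (run l v)) <= N)%N
        & all_steps (fun acc h => safe N s (VPair h (VPair acc v)))
            (fun acc h => run s (VPair h (VPair acc v)))
            (run i v) (vlist (run l v))]
  end.

Fixpoint rename (n : nat) (e : expr) : expr :=
  match e with
  | EVar _ => EVar n
  | ENil => ENil
  | EPair a b => EPair (rename n a) (rename n b)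
  | EFst a => EFst (rename n a)
  | ESnd a => ESnd (rename n a)
  | EReal q => EReal q
  | EAdd a b => EAdd (rename n a) (rename n b)
  | ESub a b => ESub (rename n a) (rename n b)
  | EScale q a => EScale q (rename n a)
  | ELe a b => ELe (rename n a) (rename n b)
  end.

Lemma size_rename n e : expr_size (rename n e) = expr_size e.
Proof. by elim: e => //= [a -> b ->|a ->|a ->|a -> b ->|a -> b ->|q a ->|a -> b ->]. Qed.

Lemma eval_rename (R : realType) (s : store R) n e :
  teval s (rename n e) = teval (fun=> s n) e.
Proof. by elim: e => //= [a -> b ->|a ->|a ->|a -> b ->|a -> b ->|q a ->|a -> b ->]. Qed.

(* Reads its argument from, and leaves its result in, the variable n; the
   variables below n are preserved and those above n are scratch. *)
Fixpoint compile (f : fn) (n : nat) : cmd :=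
  match f with
  | FE e => CAssign n (rename n e)
  | FC g f => CSeq (compile f n) (compile g n)
  | FP f g =>
      CSeq (CAssign n.+1 (EVar n)) (CSeq (compile f n.+1)
      (CSeq (CAssign n.+2 (EVar n)) (CSeq (compile g n.+2)
      (CAssign n (EPair (EVar n.+1) (EVar n.+2))))))
  | FI c f g =>
      CSeq (CAssign n.+1 (EVar n)) (CSeq (compile c n.+1)
      (CIf (EVar n.+1) (compile f n) (compile g n)))
  | FL l i s =>
      CSeq (CAssign n.+1 (EVar n)) (CSeq (compile l n.+1)
      (CSeq (CAssign n.+2 (EVar n)) (CSeq (compile i n.+2)
      (CSeq (CWhile (EVar n.+1)
        (CSeq (CAssign n.+3 (EPair (EFst (EVar n.+1))
                                   (EPair (EVar n.+2) (EVar n))))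
        (CSeq (CAssign n.+1 (ESnd (EVar n.+1)))
        (CSeq (compile s n.+3) (CAssign n.+2 (EVar n.+3))))))
      (CAssign n (EVar n.+2))))))
  end.

(** The constants pay for the assignments and tests emitted by [compile]; both branches of a
    conditional are charged. *)
Fixpoint cost (f : fn) (N : nat) : nat :=
  match f with
  | FE e => (expr_size e).+1
  | FC g f => cost f N + cost g N
  | FP f g => cost f N + cost g N + 8
  | FI c f g => cost c N + cost f N + cost g N + 4
  | FL l i s => cost l N + cost i N + N * (cost s N + 16) + 8
  end.

Definition runs_in (R : realType) (c : cmd) (n : nat) (s : store R) (o : tree R)
    (b : nat) : Prop :=
  exists t s', [/\ exec c s t s', s' n = o, (forall x, x < n -> s' x = s x)%N
                 & (t <= b)%N].

Lemma exec_assign (R : realType) (s : store R) x e t :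
  t = (expr_size e).+1 -> exec (CAssign x e) s t (update s x (teval s e)).
Proof. by move=> ->; constructor. Qed.

Lemma update_eq (R : realType) (s : store R) x v : update s x v x = v.
Proof. by rewrite /update eqxx. Qed.

Lemma update_neq (R : realType) (s : store R) x v y :
  y != x -> update s x v y = s y.
Proof. by rewrite /update => /negbTE ->. Qed.

(** Induction on [f]. Values that must survive a subprogram sit in variables below the one at which
    it runs, and [runs_in] guarantees that these are preserved. *)
Lemma compileP (R : realType) (N : nat) (f : fn) :
  forall (v : tree R) (n : nat) (s : store R), safe N f v -> s n = v ->
    runs_in (compile f n) n s (run f v) (cost f N).
Proof.
elim: f => [e|g IHg f IHf|f IHf g IHg|c IHc f IHf g IHg|l IHl i IHi b IHb] v n s.
- move=> _ sn; exists (expr_size e).+1, (update s n (teval s (rename n e))).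
  split=> //=.
  + by apply: exec_assign; rewrite size_rename.
  + by rewrite update_eq eval_rename sn.
  + by move=> x xn; rewrite update_neq //; lia.
- move=> [sf sg] sn; have [t1 [s1 [e1 o1 p1 l1]]] := IHf v n s sf sn.
  have [t2 [s2 [e2 o2 p2 l2]]] := IHg _ n s1 sg o1.
  exists (t1 + t2)%N, s2; split=> //=; first exact: ExecSeq e1 e2.
  + by move=> x xn; rewrite p2 // p1.
  + exact: leq_add.
- move=> [sf sg] sn.
  pose s0 := update s n.+1 (s n).
  have [t1 [s1 [e1 o1 p1 l1]]] : runs_in (compile f n.+1) n.+1 s0 (run f v) (cost f N).
    by apply: IHf => //; rewrite /s0 update_eq.
  have s1n : s1 n = v by rewrite p1 // /s0 update_neq //; lia.
  pose s2 := update s1 n.+2 (s1 n).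
  have [t3 [s3 [e3 o3 p3 l3]]] : runs_in (compile g n.+2) n.+2 s2 (run g v) (cost g N).
    by apply: IHg => //; rewrite /s2 update_eq.
  pose s4 := update s3 n (VPair (s3 n.+1) (s3 n.+2)).
  exists (2 + (t1 + (2 + (t3 + 4))))%N, s4; split=> //=.
  + apply: ExecSeq; first exact: exec_assign.
    apply: ExecSeq; first exact: e1.
    apply: ExecSeq; first exact: exec_assign.
    apply: ExecSeq; first exact: e3.
    exact: exec_assign.
  + by rewrite /s4 update_eq o3 p3 // /s2 update_neq ?o1 //; lia.
  + move=> x xn; have x1 := ltnW (ltnW xn : x < n.+1)%N.
    rewrite /s4 update_neq; last by lia.
    rewrite p3; last by lia.
    rewrite /s2 update_neq; last by lia.
    rewrite p1; last by lia.
    by rewrite /s0 update_neq //; lia.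
  + lia.
- move=> [sc sfg] sn.
  pose s0 := update s n.+1 (s n).
  have [t1 [s1 [e1 o1 p1 l1]]] : runs_in (compile c n.+1) n.+1 s0 (run c v) (cost c N).
    by apply: IHc => //; rewrite /s0 update_eq.
  have s1n : s1 n = v by rewrite p1 // /s0 update_neq //; lia.
  have [t2 [s2 [e2 o2 p2 l2]]] : runs_in
      (if truth (teval s1 (EVar n.+1)) then compile f n else compile g n)
      n s1 (run (FI c f g) v) (cost f N + cost g N).
    rewrite /= o1; case: (truth (run c v)) sfg => sfg.
      have [t [s' [? ? ? lt]]] := IHf v n s1 sfg s1n.
      by exists t, s'; split=> //; apply: leq_trans lt (leq_addr _ _).
    have [t [s' [? ? ? lt]]] := IHg v n s1 sfg s1n.
    by exists t, s'; split=> //; apply: leq_trans lt (leq_addl _ _).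
  exists (2 + (t1 + (1 + t2).+1))%N, s2; split=> //=.
  + apply: ExecSeq; first exact: exec_assign.
    by apply: ExecSeq; [exact: e1|exact: ExecIf].
  + move=> x xn; rewrite p2 // p1; last by lia.
    by rewrite /s0 update_neq //; lia.
  + lia.
- move=> [sl si sN sb] sn.
  pose s0 := update s n.+1 (s n).
  have [t1 [s1 [e1 o1 p1 l1]]] : runs_in (compile l n.+1) n.+1 s0 (run l v) (cost l N).
    by apply: IHl => //; rewrite /s0 update_eq.
  have s1n : s1 n = v by rewrite p1 // /s0 update_neq //; lia.
  pose s2 := update s1 n.+2 (s1 n).
  have [t3 [s3 [e3 o3 p3 l3]]] : runs_in (compile i n.+2) n.+2 s2 (run i v) (cost i N).
    by apply: IHi => //; rewrite /s2 update_eq.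
  have s3l : s3 n.+1 = run l v by rewrite p3 // /s2 update_neq //; lia.
  have s3n : s3 n = v.
    by rewrite p3 // /s2 update_neq; last lia.
  have s3x x : (x < n -> s3 x = s x)%N.
    move=> xn; rewrite p3; last by lia.
    rewrite /s2 update_neq; last by lia.
    rewrite p1; last by lia.
    by rewrite /s0 update_neq //; lia.
  pose body := CSeq (CAssign n.+3 (EPair (EFst (EVar n.+1))
                                   (EPair (EVar n.+2) (EVar n))))
        (CSeq (CAssign n.+1 (ESnd (EVar n.+1)))
        (CSeq (compile b n.+3) (CAssign n.+2 (EVar n.+3)))).
  (* Loop invariant: variable n+1 holds the rest of the list, n+2 the accumulator and n the
     argument; each round costs at most [cost b N + 16]. *)
  have loop : forall (xs : seq (tree R)) (acc : tree R) (z : store R),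
    vlist (z n.+1) = xs -> z n.+2 = acc -> z n = v ->
    all_steps (fun acc h => safe N b (VPair h (VPair acc v)))
            (fun acc h => run b (VPair h (VPair acc v))) acc xs ->
    exists t z', [/\ exec (CWhile (EVar n.+1) body) z t z',
      z' n.+2 = foldl (fun acc h => run b (VPair h (VPair acc v))) acc xs,
      (forall x, x < n.+1 -> z' x = z x)%N & (t <= size xs * (cost b N + 16) + 2)%N].
    elim=> [|h xs IH] acc z zl za zn /=.
      move=> _; exists 2%N, z; split=> //.
      by apply: ExecWhileF; move: zl; rewrite /=; case: (z n.+1).
    move=> [sh sxs].
    pose z1 := update z n.+3 (VPair h (VPair acc v)).
    pose z2 := update z1 n.+1 (teval z1 (ESnd (EVar n.+1))).
    have z21 : z2 n.+3 = VPair h (VPair acc v).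
      rewrite /z2 update_neq; last by lia.
      by rewrite /z1 update_eq.
    have [t4 [z3 [e4 o4 p4 l4]]] := IHb _ n.+3 z2 sh z21.
    pose z4 := update z3 n.+2 (z3 n.+3).
    have z4x x : (x < n.+1)%N -> z4 x = z x.
      move=> xn; rewrite /z4 update_neq; last by lia.
      rewrite p4; last by lia.
      rewrite /z2 update_neq; last by lia.
      by rewrite /z1 update_neq //; lia.
    have [t5 [z5 [e5 o5 p5 l5]]] : exists t z', [/\ exec (CWhile (EVar n.+1) body) z4 t z',
      z' n.+2 = foldl (fun acc h => run b (VPair h (VPair acc v)))
                  (run b (VPair h (VPair acc v))) xs,
      (forall x, x < n.+1 -> z' x = z4 x)%N & (t <= size xs * (cost b N + 16) + 2)%N].
      apply: IH => //.
      - rewrite /z4 update_neq; last by lia.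
        rewrite p4 // /z2 update_eq /= /z1 update_neq; last by lia.
        by move: zl; case: (z n.+1) => //= [r|v1 v2] [].
      - by rewrite /z4 update_eq.
      - by rewrite z4x.
    have lb : (size (h :: xs) * (cost b N + 16) + 2 =
               (cost b N + 16) + (size xs * (cost b N + 16) + 2))%N.
      by rewrite /= mulSn addnA.
    exists ((1 + (6 + 1 + (3 + (t4 + 2))) + t5).+1)%N, z5; split=> //.
    + have tz : truth (teval z (EVar n.+1)).
        by move: zl; rewrite /=; case: (z n.+1).
      apply: (@ExecWhileT _ z z4) => //.
      apply: (@ExecSeq _ _ z1).
        have -> : z1 = update z n.+3 (teval z (EPair (EFst (EVar n.+1))
                                   (EPair (EVar n.+2) (EVar n)))).
          rewrite /z1 /= za zn; congr (update _ _ (VPair _ _)).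
          by move: zl; case: (z n.+1) => //= [r|v1 v2] [->].
        exact: exec_assign.
      apply: (@ExecSeq _ _ z2); first exact: exec_assign.
      by apply: ExecSeq; [exact: e4|exact: exec_assign].
    + by move=> x xn; rewrite p5 // z4x.
    + by rewrite lb; lia.
  have [t5 [s5 [e5 o5 p5 l5]]] := loop _ _ s3 erefl o3 s3n (eq_ind_r
    (fun u => all_steps _ _ _ (vlist u)) sb s3l).
  pose s6 := update s5 n (s5 n.+2).
  exists (2 + (t1 + (2 + (t3 + (t5 + 2)))))%N, s6; split=> //=.
  + apply: ExecSeq; first exact: exec_assign.
    apply: ExecSeq; first exact: e1.
    apply: ExecSeq; first exact: exec_assign.
    apply: ExecSeq; first exact: e3.
    apply: ExecSeq; first exact: e5.
    exact: exec_assign.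
  + by rewrite /s6 update_eq o5 s3l.
  + move=> x xn; rewrite /s6 update_neq; last by lia.
    by rewrite p5 ?s3x //; lia.
  + have l5' : (t5 <= N * (cost b N + 16) + 2)%N.
      apply: leq_trans l5 _; rewrite leq_add2r leq_mul2r s3l sN orbT //.
    by lia.
Qed.

(** Monomials suffice, since a N^k + b N^l <= (a+b) N^(k+l) for N > 0; a fold raises the exponent by
    one. *)
Lemma cost_poly f : exists a k, forall N, (0 < N)%N -> (cost f N <= a * N ^ k)%N.
Proof.
have mono a k k' N : (0 < N -> k <= k' -> a * N ^ k <= a * N ^ k')%N.
  by move=> N0 kk; rewrite leq_mul2l leq_pexp2l ?orbT.
have cst a k N : (0 < N -> a <= a * N ^ k)%N.
  by move=> N0; rewrite -{1}[a]muln1 leq_mul2l expn_gt0 N0 orbT.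
have add2 a b k l N : (0 < N -> a * N ^ k + b * N ^ l <= (a + b) * N ^ (k + l))%N.
  by move=> N0; rewrite mulnDl leq_add // mono // (leq_addr, leq_addl).
elim: f => [e|g [a1 [k1 H1]] f [a2 [k2 H2]]|f [a1 [k1 H1]] g [a2 [k2 H2]]
  |c [a1 [k1 H1]] f [a2 [k2 H2]] g [a3 [k3 H3]]
  |l [a1 [k1 H1]] i [a2 [k2 H2]] s [a3 [k3 H3]]] /=.
- by exists (expr_size e).+1, 0%N => N _; rewrite muln1.
- exists (a2 + a1)%N, (k2 + k1)%N => N N0.
  by apply: leq_trans (add2 _ _ _ _ _ N0); rewrite leq_add ?H1 ?H2.
- exists (a1 + a2 + 8)%N, (k1 + k2 + 0)%N => N N0.
  apply: leq_trans (add2 _ _ _ _ _ N0); rewrite expn0 muln1 leq_add2r.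
  by apply: leq_trans (add2 _ _ _ _ _ N0); rewrite leq_add ?H1 ?H2.
- exists (a1 + a2 + a3 + 4)%N, (k1 + k2 + k3 + 0)%N => N N0.
  apply: leq_trans (add2 _ _ _ _ _ N0); rewrite expn0 muln1 leq_add2r.
  apply: leq_trans (add2 _ _ _ _ _ N0); rewrite leq_add ?H3 //.
  by apply: leq_trans (add2 _ _ _ _ _ N0); rewrite leq_add ?H1 ?H2.
- exists (a1 + a2 + (a3 + 16) + 8)%N, (k1 + k2 + (k3 + 0).+1 + 0)%N => N N0.
  apply: leq_trans (add2 _ _ _ _ _ N0); rewrite expn0 muln1 leq_add2r.
  apply: leq_trans (add2 _ _ _ _ _ N0); rewrite leq_add //.
    by apply: leq_trans (add2 _ _ _ _ _ N0); rewrite leq_add ?H1 ?H2.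
  rewrite expnS mulnCA leq_mul2l; apply/orP; right.
  apply: leq_trans (add2 _ _ _ _ _ N0); rewrite expn0 muln1 leq_add2r.
  exact: H3.
Qed.

(** * Walks and distances *)

(** Walks may repeat vertices and [r] only bounds the cost from above, which makes concatenation,
    reversal and weakening direct. *)
Definition walk (R : realType) (G : sgraph) (p : pricing R G) (x y : G) (r : R) :=
  exists2 s, path (@adj G) x s && (last x s == y) & path_cost p x s <= r.

Definition dist (R : realType) (G : sgraph) (p : pricing R G) (x y : G) : R :=
  fine (lowest_cost p x y).

Section Walks.
Variables (R : realType) (G : sgraph) (p : pricing R G).
Implicit Types (x y z : G) (s : seq G) (r : R).

Lemma path_cost_cat x s t :
  path_cost p x (s ++ t) = path_cost p x s + path_cost p (last x s) t.
Proof. by elim: s x => [|y s IH] x /=; rewrite ?add0r // IH addrA. Qed.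

Lemma path_cost_ge0 x s : path (@adj G) x s -> 0 <= path_cost p x s.
Proof.
elim: s x => [|y s IH] x //= /andP[xy ys].
by rewrite addr_ge0 ?IH ?price_ge0.
Qed.

Lemma walk_refl x : walk p x x 0.
Proof. by exists [::] => //=; rewrite eqxx. Qed.

Lemma walk_le x y r r' : r <= r' -> walk p x y r -> walk p x y r'.
Proof. by move=> rr' [s ? sr]; exists s => //; exact: le_trans rr'. Qed.

Lemma walk_trans y x z r r' : walk p x y r -> walk p y z r' -> walk p x z (r + r').
Proof.
move=> [s /andP[ps /eqP <-] cs] [t /andP[pt lt] ct]; exists (s ++ t).
  by rewrite cat_path ps pt last_cat.
by rewrite path_cost_cat lerD.
Qed.

Lemma walk_edge x y : adj x y -> walk p x y (p [set x; y]).
Proof. by move=> xy; exists [:: y]; rewrite /= ?xy ?eqxx ?addr0. Qed.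

Lemma walk_sym x y r : walk p x y r -> walk p y x r.
Proof.
move=> [s]; elim: s x y r => [|z s IH] x y r /=.
  by move=> /eqP <- r0; apply: walk_le r0 (walk_refl _).
move=> /andP[/andP[xz zs] l] cr.
apply: walk_le cr _; rewrite addrC; apply: (@walk_trans z).
  by apply: IH (lexx _); rewrite zs.
by rewrite finset.setUC; apply: walk_edge; rewrite adj_sym.
Qed.

(** Loop erasure: if [x] recurs on the simple path already found for the tail, only the part after
    that occurrence is kept; nonnegative prices make this no dearer. *)
Lemma walk_upath x y r :
  walk p x y r -> exists2 s, is_upath x y s & path_cost p x s <= r.
Proof.
move=> [s]; elim: s x r => [|z s IH] x r /=.
  by move=> /eqP <- r0; exists [::]; rewrite /is_upath /= ?eqxx.
move=> /andP[/andP[xz zs] l] cr.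
have [t /and3P[pt ut lt] ct] := IH z (path_cost p z s) (introT andP (conj zs l)) (lexx _).
have [xt|xt] := boolP (x \in z :: t); last first.
  exists (z :: t); first by rewrite /is_upath /= xz pt xt lt; move: ut => /= ->.
  by apply: le_trans cr; rewrite /= lerD.
have {}xt : x \in t.
  by move: xt; rewrite inE => /orP[/eqP xz'|//]; rewrite xz' adj_irr in xz.
case/splitPr: xt => t1 t2 in pt ut lt ct *.
exists t2.
  move: pt ut lt; rewrite /is_upath cat_path last_cat => /and3P[_ _ p2].
  by rewrite -cat_cons cat_uniq => /and3P[_ _ ut] lt; apply/and3P.
have {}cr : path_cost p z s <= r.
  by apply: le_trans cr; rewrite lerDr price_ge0.
apply: le_trans (le_trans ct cr).
move: pt; rewrite path_cost_cat cat_path /= => /and3P[p1 p2 _].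
by rewrite addrA lerDr addr_ge0 ?path_cost_ge0 ?price_ge0.
Qed.

(** Simple paths have length at most [#|G|], so the minimum runs over finitely many sequences. *)
Lemma lowest_cost_attained x y r : walk p x y r ->
  exists2 s, is_upath x y s & lowest_cost p x y = (path_cost p x s)%:E.
Proof.
move=> /walk_upath[s us _].
have sz t : is_upath x y t -> (size t <= #|G|)%N.
  by case/and3P=> _ /= /andP[_ ut] _; rewrite -(card_uniqP ut) max_card.
pose t0 : {bseq #|G| of G} := Bseq (sz _ us).
case: (@arg_minP _ _ _ t0 (fun t : {bseq #|G| of G} => is_upath x y t)
  (fun t => path_cost p x t) us) => t ut tmin.
exists t => //; apply/eqP; rewrite eq_le; apply/andP; split.
  by apply: ereal_inf_lbound; exists (bseqval t).
apply: le_ereal_inf_tmp => _ [u /= uu <-]; rewrite lee_fin.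
exact: (tmin (Bseq (sz _ uu))).
Qed.

Lemma lowest_cost_le x y r : walk p x y r -> (lowest_cost p x y <= r%:E)%E.
Proof.
move=> /walk_upath[s us sr]; apply: (@le_trans _ _ (path_cost p x s)%:E).
  by apply: ereal_inf_lbound; exists s.
by rewrite lee_fin.
Qed.

(** The triangle inequality along the walk: a potential dominated by the edge prices bounds
    distances from below. *)
Lemma potential_le (F : G -> R) x y r :
  (forall u v, adj u v -> `|F u - F v| <= p [set u; v]) ->
  walk p x y r -> `|F x - F y| <= r.
Proof.
move=> Fp [s /andP[ps /eqP <-]]; apply: le_trans.
elim: s x ps => [|z s IH] x /=; first by rewrite subrr normr0.
move=> /andP[xz zs]; rewrite (le_trans (ler_distD (F z) _ _)) // lerD ?Fp //.
exact: IH.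
Qed.

Hypothesis walk_ex : forall x y, exists r, walk p x y r.

Lemma lowest_costE x y : lowest_cost p x y = (dist p x y)%:E.
Proof.
by have [r /lowest_cost_attained[s _ E]] := walk_ex x y; rewrite /dist E.
Qed.

Lemma dist_walk x y : walk p x y (dist p x y).
Proof.
have [r /lowest_cost_attained[s /and3P[ps us ls] E]] := walk_ex x y.
by exists s; rewrite ?ps // /dist E.
Qed.

Lemma dist_le x y r : walk p x y r -> dist p x y <= r.
Proof. by move=> /lowest_cost_le; rewrite lowest_costE lee_fin. Qed.

Lemma dist_ge0 x y : 0 <= dist p x y.
Proof.
have [s /andP[ps _] sr] := dist_walk x y.
exact: le_trans (path_cost_ge0 ps) sr.
Qed.

Lemma dist_sym x y : dist p x y = dist p y x.
Proof. by apply/eqP; rewrite eq_le !dist_le //; exact/walk_sym/dist_walk. Qed.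

(** A lowest-cost walk meets [P] at some z and splits there into walks to and from z; the other
    inequality is the triangle inequality. *)
Lemma dist_cut (P : pred G) x y :
  (forall s, path (@adj G) x s -> last x s = y -> has P (x :: s)) ->
  exists2 z, P z & dist p x y = dist p x z + dist p z y.
Proof.
move=> cutP; have [s /andP[ps /eqP ls] cs] := dist_walk x y.
have /hasP[z zs Pz] := cutP s ps ls; exists z => //.
apply/eqP; rewrite eq_le dist_le /=; last first.
  by apply: walk_trans; exact: dist_walk.
apply: le_trans cs; case/splitPl: zs ps ls => s1 s2 l1.
rewrite cat_path last_cat l1 path_cost_cat l1 => /andP[p1 p2] l2.
by rewrite lerD // dist_le //; [exists s1|exists s2]; rewrite ?p1 ?p2 ?l1 ?l2 ?eqxx.
Qed.

Lemma driver_revenueE d : driver_revenue p d =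
  if dist p (source d) (target d) <= budget d
  then dist p (source d) (target d) else 0.
Proof. by rewrite /driver_revenue lowest_costE lee_fin. Qed.

Lemma driver_revenue_ge0 d : 0 <= driver_revenue p d.
Proof. by rewrite driver_revenueE; case: ifP => // _; exact: dist_ge0. Qed.

End Walks.

(** * The dynamic program for the prices of the rows *)

Section Argmax.
Variables (R : realType) (T : eqType).
Implicit Types (a e : R * T) (s : seq (R * T)).

Definition argmax a s := foldl (fun a e => if e.1 <= a.1 then a else e) a s.

Lemma argmax_mem a s : argmax a s \in a :: s.
Proof.
elim: s a => [|e s IH] a /=; first exact: mem_head.
have := IH (if e.1 <= a.1 then a else e).
by case: ifP => _; rewrite !inE => /orP[->|->]; rewrite ?orbT.
Qed.

Lemma le_argmax a s e : e \in a :: s -> e.1 <= (argmax a s).1.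
Proof.
elim: s a e => [|e' s IH] a e /=; first by rewrite inE => /eqP ->.
have le0 a' : a'.1 <= (argmax a' s).1 by apply: IH; exact: mem_head.
have [le'|/ltW le'] := lerP e'.1 a.1.
  rewrite 2!inE => /or3P[/eqP ->//|/eqP ->|es]; first exact: le_trans le' (le0 _).
  by apply: IH; rewrite inE es orbT.
rewrite 2!inE => /or3P[/eqP ->|/eqP ->//|es]; first exact: le_trans le' (le0 _).
by apply: IH; rewrite inE es orbT.
Qed.

End Argmax.

(* The dynamic program chooses the prices f i of the rows i one row after the
   other; the rows already treated form a stack d.  An entry (v, (x, t)) stands
   for a choice of total reward v, with price x at the top of the stack and
   with the prices recorded in the association list t. *)
Section DynamicProgram.
Variables (R : realType) (priced : pred nat) (free : bool) (cands : seq R)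
  (reward : nat -> R -> R).

Definition entry : Type := R * (R * seq (nat * R)).

(** Summing instead of searching gives price 0 to absent rows; a row treated once is recorded at
    most once. *)
Definition lookup (t : seq (nat * R)) (i : nat) : R :=
  \sum_(e <- t | e.1 == i) e.2.

Definition entry0 : entry := (0, (0, [::])).

(** Only the price at the top of the stack constrains the next one, so for each candidate x the best
    admissible predecessor is kept. The default [entry0], with all prices 0, is admissible for every
    nonnegative candidate. *)
Definition dp_step (i : nat) (L : seq entry) : seq entry :=
  if priced i then
    [seq let e := argmax entry0 [seq e <- L | free || (e.2.1 <= x)] in
         (e.1 + reward i x, (x, (i, x) :: e.2.2)) | x <- cands]
  else let e := argmax entry0 L in [:: (e.1, (0, e.2.2))].

Definition dp (d : seq nat) : seq entry := foldr dp_step [:: entry0] d.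

(** Here [i] lies on top of [j]. An unpriced [i] imposes nothing: its price is 0, and the climb
    starts afresh above it. *)
Fixpoint climbs (f : nat -> R) (d : seq nat) : bool :=
  if d is i :: d' then
    (if d' is j :: _ then priced i ==> (free || (f j <= f i)) else true)
    && climbs f d'
  else true.

Definition top (f : nat -> R) (d : seq nat) : R := if d is i :: _ then f i else 0.

Lemma eq_climbs f g d : {in d, f =1 g} -> climbs f d = climbs g d.
Proof.
elim: d => [|i d IH] fg //=; rewrite IH => [|j jd]; last by rewrite fg // inE jd orbT.
by case: d fg {IH} => [|j d] fg //; rewrite !fg // !inE ?eqxx ?orbT.
Qed.

Hypothesis cands_ge0 : {in cands, forall x, 0 <= x}.
Hypothesis reward0 : forall i, reward i 0 = 0.

Definition sound (d : seq nat) (e : entry) :=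
  let f := lookup e.2.2 in
  [/\ forall i, 0 <= f i, forall i, ~~ (priced i && (i \in d)) -> f i = 0,
      climbs f d, e.1 = \sum_(i <- d) reward i (f i) & e.2.1 = top f d].

Lemma sound0 d : sound d entry0.
Proof.
have f0 i : lookup [::] i = 0 by rewrite /lookup big_nil.
split=> [i|i _|||] /=; rewrite ?f0 //.
- by elim: d => //= i [|j d] //= ->; rewrite !f0 lexx orbT implybT.
- by rewrite big1 // => i _; rewrite f0 reward0.
- by case: d => //= i d; rewrite f0.
Qed.

Lemma lookup_cons i x t j : lookup ((i, x) :: t) j = (if i == j then x else 0) + lookup t j.
Proof. by rewrite /lookup big_cons /=; case: ifP; rewrite ?add0r. Qed.

Lemma dp_sound d e : uniq d -> e \in dp d -> sound d e.
Proof.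
elim: d e => [|i d IH] e /=; first by rewrite inE => _ /eqP ->; exact: sound0.
move=> /andP[idd ud]; rewrite /dp_step.
have dsound L : {subset L <= dp d} -> sound d (argmax entry0 L).
  move=> sL; have := argmax_mem entry0 L; rewrite inE => /orP[/eqP ->|/sL eL].
    exact: sound0.
  exact: IH.
case: ifPn => pi; last first.
  rewrite inE => /eqP ->; have [f0 fN fc fv fx] := dsound (dp d) (fun _ => id).
  split=> //=.
  - move=> k; rewrite inE negb_and => /orP[nk|]; first by apply: fN; rewrite (negbTE nk).
    by rewrite negb_or => /andP[_ kd]; apply: fN; rewrite (negbTE kd) andbF.
  - by rewrite fc (negbTE pi) andbT; case: (d).
  - by rewrite big_cons fv fN ?(negbTE pi) // reward0 add0r.
  - by rewrite fN // (negbTE pi).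
move=> /mapP[x xc ->] /=.
set L := [seq e <- dp d | _]; set a := argmax entry0 L.
have [f0 fN fc fv fx] : sound d a by apply: dsound => e'; rewrite mem_filter => /andP[].
(* If the maximum is the default [entry0], its top price 0 lies below the candidate [x]. *)
have ax : free || (a.2.1 <= x).
  have := argmax_mem entry0 L; rewrite -/a inE => /orP[/eqP ->|].
    by rewrite cands_ge0 ?orbT.
  by rewrite mem_filter => /andP[].
have fi : lookup a.2.2 i = 0 by apply: fN; rewrite (negbTE idd) andbF.
(* Row [i] does not occur in [d], so recording its price leaves the prices of the earlier rows
   unchanged. *)
have fd : {in d, lookup ((i, x) :: a.2.2) =1 lookup a.2.2}.
  move=> j jd; rewrite lookup_cons; case: eqP => [ij|_]; last by rewrite add0r.
  by rewrite ij jd in idd.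
split=> /=.
- by move=> k; rewrite lookup_cons addr_ge0 //; case: ifP => // _; exact: cands_ge0.
- move=> k; rewrite inE lookup_cons eq_sym => nk; rewrite fN.
    by case: (eqVneq k i) nk => [->|_ _]; rewrite ?pi ?addr0.
  by apply: contra nk => /andP[-> ->]; rewrite orbT.
- rewrite (eq_climbs fd) fc andbT.
  case: (d) fx fd => [//|j d'] /= fx fd.
  by rewrite pi /= fd ?mem_head // -fx lookup_cons eqxx fi addr0.
- rewrite big_cons lookup_cons eqxx fi addr0 addrC fv; congr (_ + _).
  by rewrite !big_seq; apply: eq_bigr => j jd; rewrite fd.
- by rewrite lookup_cons eqxx fi addr0.
Qed.

(** The induction follows [f]: some entry has its top price and at least its reward, so the next
    price of [f] may extend that entry, and the best predecessor is no worse. *)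
Lemma dp_opt f d : (forall i, 0 <= f i) -> (forall i, ~~ priced i -> f i = 0) ->
  climbs f d -> {in d, forall i, priced i -> f i \in cands} ->
  exists2 e, e \in dp d & \sum_(i <- d) reward i (f i) <= e.1 /\ e.2.1 = top f d.
Proof.
move=> f0 fN; elim: d => [|i d IH] /=.
  by exists entry0; rewrite ?mem_head ?big_nil.
move=> /andP[ci cd] fc.
have [e ed [ev ex]] := IH cd (fun j jd => fc j (@mem_behead _ (i :: d) j jd)).
rewrite /dp_step; case: ifPn => pi; last first.
  eexists; first exact: mem_head.
  rewrite big_cons /= fN // reward0 add0r; split=> //.
  by apply: le_trans ev _; rewrite le_argmax // inE ed orbT.
eexists; first by apply: map_f; apply: fc pi; exact: mem_head.
split=> //=; rewrite big_cons addrC lerD2r; apply: le_trans ev _.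
rewrite le_argmax // inE mem_filter ed andbT ex.
by case: (d) ci => [|j d'] /=; rewrite ?f0 ?pi //= ?orbT // => ->; rewrite orbT.
Qed.

End DynamicProgram.

(** * Rounding prices up to candidates *)

Section Rounding.
Variables (R : realType) (s : seq R).
Hypothesis s_ge0 : {in s, forall x, 0 <= x}.
Hypothesis s0 : 0 \in s.

Let M : R := foldr Num.max 0 s.

(* The least element of s above x, or the greatest element of s when x exceeds
   them all. *)
Definition round_up (x : R) : R :=
  foldr (fun b a => if (x <= b) && (b <= a) then b else a) M s.

Lemma round_up_mem x : round_up x \in s.
Proof.
have Ms : M \in s.
  have : M \in 0 :: s.
    rewrite /M; elim: (s) => [|y t IH] /=; first exact: mem_head.
    have [_|_] := leP y (foldr Num.max 0 t); last by rewrite !inE eqxx orbT.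
    by move: IH; rewrite !inE => /orP[->|->]; rewrite ?orbT.
  by rewrite inE => /orP[/eqP ->|].
have : round_up x \in M :: s.
  rewrite /round_up; elim: (s) => [|y t IH] /=; first exact: mem_head.
  by case: ifP => _; [|move: IH]; rewrite !inE ?eqxx ?orbT // => /orP[->|->]; rewrite ?orbT.
by rewrite inE => /orP[/eqP ->|].
Qed.

Lemma le_max_cands b : b \in s -> b <= M.
Proof.
rewrite /M; elim: (s) => [//|y t IH] /=; rewrite inE le_max => /orP[/eqP ->|/IH ->].
  by rewrite lexx.
by rewrite orbT.
Qed.

Lemma round_up_ge x : x <= M -> x <= round_up x.
Proof.
by move=> xM; rewrite /round_up; elim: (s) => [//|y t IH] /=; case: ifP => // /andP[].
Qed.

Lemma round_up_le x b : b \in s -> x <= b -> round_up x <= b.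
Proof.
rewrite /round_up; elim: (s) => [//|y t IH] /=; rewrite inE => /orP[/eqP ->|bt] xb.
  by rewrite xb /=; case: (leP y) => // /ltW.
have := IH bt xb; set a := foldr _ _ _; case: ifP => // /andP[_ ya] ab.
exact: le_trans ab.
Qed.

Lemma round_up_leM x : round_up x <= M.
Proof. exact/le_max_cands/round_up_mem. Qed.

(** If [round_up y] lies below [x], then [y] exceeds all of [s] and [round_up y] is the maximum [M];
    otherwise [round_up y] competes in the minimum defining [round_up x]. *)
Lemma round_up_homo x y : x <= y -> round_up x <= round_up y.
Proof.
move=> xy; have [xr|rx] := leP x (round_up y).
  exact: round_up_le (round_up_mem y) xr.
have yM : M < y.
  by rewrite ltNge; apply: contraL rx => /round_up_ge yr; rewrite -leNgt (le_trans xy).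
suff -> : round_up y = M by exact: round_up_leM.
rewrite /round_up; elim: (s) (le_max_cands) => [//|z t IH] zM /=.
rewrite IH => [|b bt]; last by apply: zM; rewrite inE bt orbT.
by rewrite leNgt (le_lt_trans (zM z (mem_head _ _)) yM).
Qed.

Lemma round_up_ge0 x : 0 <= round_up x.
Proof. exact/s_ge0/round_up_mem. Qed.

End Rounding.

(** * Prices given by a potential *)

Section Potential.
Variables (R : realType) (G : sgraph).

(** Prices are functions of vertex sets, so the price of an edge is written as a symmetric double
    sum, halved because each pair occurs in both orders. *)
Definition pot_cost (F : G -> R) (S : {set G}) : R :=
  2^-1 * \sum_(x in S) \sum_(y in S) `|F x - F y|.

Lemma pot_costE F x y : pot_cost F [set x; y] = `|F x - F y|.
Proof.
rewrite /pot_cost; have [->|xy] := eqVneq x y.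
  by rewrite finset.setUid !big_set1 subrr normr0 mulr0.
rewrite big_setU1 ?inE //= big_set1 !big_setU1 ?inE //= !big_set1 !subrr normr0.
by rewrite add0r addr0 [`|F y - F x|]distrC; lra.
Qed.

Lemma pot_cost_ge0 F x y : adj x y -> 0 <= pot_cost F [set x; y].
Proof. by rewrite pot_costE. Qed.

Definition pot_pricing F : pricing R G := Pricing (pot_cost_ge0 F).

Lemma walk_line (p : pricing R G) (g : nat -> G) a n :
  (forall k, (k < n)%N -> adj (g (a + k)%N) (g (a + k).+1)) ->
  walk p (g a) (g (a + n)%N)
    (\sum_(k < n) p [set g (a + k)%N; g (a + k).+1]).
Proof.
elim: n => [|n IH] ga; first by rewrite addn0 big_ord0; exact: walk_refl.
rewrite big_ord_recr addnS; apply: walk_trans (IH _) _ => [k kn|].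
  by apply: ga; rewrite ltnW.
exact/walk_edge/ga.
Qed.

(** On a monotone stretch the absolute differences telescope. *)
Lemma pot_walk_incr (F : G -> R) (g : nat -> G) a n :
  (forall k, (k < n)%N -> adj (g (a + k)%N) (g (a + k).+1)) ->
  (forall k, (k < n)%N -> F (g (a + k)%N) <= F (g (a + k).+1)) ->
  walk (pot_pricing F) (g a) (g (a + n)%N) (F (g (a + n)%N) - F (g a)).
Proof.
move=> ga gF; apply: walk_le (walk_line _ ga); rewrite le_eqVlt; apply/orP; left; apply/eqP.
have := telescope_sumr (fun k => F (g (a + k)%N)) (leq0n n).
rewrite /= addn0 big_mkord => <-; apply: eq_bigr => k _ /=.
by rewrite pot_costE distrC ger0_norm ?addnS // subr_ge0 gF.
Qed.

Lemma pot_walk_decr (F : G -> R) (g : nat -> G) a n :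
  (forall k, (k < n)%N -> adj (g (a + k)%N) (g (a + k).+1)) ->
  (forall k, (k < n)%N -> F (g (a + k).+1) <= F (g (a + k)%N)) ->
  walk (pot_pricing F) (g a) (g (a + n)%N) (F (g a) - F (g (a + n)%N)).
Proof.
move=> ga gF; apply: walk_le (walk_line _ ga); rewrite le_eqVlt; apply/orP; left; apply/eqP.
have := telescope_sumr (fun k => F (g (a + k)%N)) (leq0n n).
rewrite /= addn0 big_mkord => E; rewrite -opprB -E -sumrN; apply: eq_bigr => k _ /=.
by rewrite pot_costE ger0_norm ?addnS ?opprB // subr_ge0 gF.
Qed.

End Potential.

(** * Walks in the grid *)

Section Grid.
Variables (m w : nat).
Implicit Types (u v : grid m w) (i : 'I_m) (j : 'I_w).

(** Lines are indexed by natural numbers, as [walk_line] expects; out of range, [insubd] returns the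
    given index. *)
Definition gcol i j (k : nat) : grid m w := (insubd i k, j).
Definition grow i j (k : nat) : grid m w := (i, insubd j k).

Lemma gcol_adj i j k : (k.+1 < m)%N -> adj (gcol i j k) (gcol i j k.+1).
Proof.
move=> km; rewrite /= /grid_adj /grid_next /= !val_insubd km (ltnW km).
by rewrite !eqxx orbT.
Qed.

Lemma grow_adj i j k : (k.+1 < w)%N -> adj (grow i j k) (grow i j k.+1).
Proof.
move=> km; rewrite /= /grid_adj /grid_next /= !val_insubd km (ltnW km).
by rewrite !eqxx.
Qed.

Lemma gcolE i j i' : gcol i j i' = (i', j).
Proof. by congr (_, _); apply: val_inj; rewrite val_insubd ltn_ord. Qed.

Lemma growE i j j' : grow i j j' = (i, j').
Proof. by congr (_, _); apply: val_inj; rewrite val_insubd ltn_ord. Qed.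

Section Columns.
Variables (R : realType) (F : grid m w -> R).

Lemma pot_col_incr i i' j : (i <= i')%N ->
  (forall k k' : 'I_m, (i <= k)%N -> (k' <= i')%N -> k' = k.+1 :> nat ->
     F (k, j) <= F (k', j)) ->
  walk (pot_pricing F) (i, j) (i', j) (F (i', j) - F (i, j)).
Proof.
move=> ii' H; have lt k : (k < i' - i)%N -> ((i + k).+1 < m)%N.
  by move=> kn; apply: leq_ltn_trans (ltn_ord i'); rewrite -addnS -leq_subRL.
have := @pot_walk_incr R (grid m w) F (gcol i j) i (i' - i).
rewrite subnKC // !gcolE; apply=> k kn; first exact/gcol_adj/lt.
by apply: H; rewrite ?val_insubd ?lt // ?(ltnW (lt _ kn)) ?leq_addr // -addnS -leq_subRL.
Qed.

Lemma pot_col_decr i i' j : (i <= i')%N ->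
  (forall k k' : 'I_m, (i <= k)%N -> (k' <= i')%N -> k' = k.+1 :> nat ->
     F (k', j) <= F (k, j)) ->
  walk (pot_pricing F) (i, j) (i', j) (F (i, j) - F (i', j)).
Proof.
move=> ii' H; have lt k : (k < i' - i)%N -> ((i + k).+1 < m)%N.
  by move=> kn; apply: leq_ltn_trans (ltn_ord i'); rewrite -addnS -leq_subRL.
have := @pot_walk_decr R (grid m w) F (gcol i j) i (i' - i).
rewrite subnKC // !gcolE; apply=> k kn; first exact/gcol_adj/lt.
by apply: H; rewrite ?val_insubd ?lt // ?(ltnW (lt _ kn)) ?leq_addr // -addnS -leq_subRL.
Qed.

Lemma pot_col0 i i' j : (forall k, F (k, j) = 0) ->
  walk (pot_pricing F) (i, j) (i', j) 0.
Proof.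
move=> F0; wlog ii' : i i' / (i <= i')%N => [IH|].
  by case: (leqP i i') => [|/ltnW] /IH // /walk_sym.
have := @pot_col_incr i i' j ii' _; rewrite !F0 subrr; apply=> k k' _ _ _.
by rewrite !F0.
Qed.

Lemma pot_row0 i j j' :
  (forall k : 'I_w, (minn j j' <= k <= maxn j j')%N -> F (i, k) = 0) ->
  walk (pot_pricing F) (i, j) (i, j') 0.
Proof.
wlog jj' : j j' / (j <= j')%N => [IH|].
  case/orP: (leq_total j j') => jj' F0; first exact: IH.
  by apply/walk_sym/IH => // k; rewrite minnC maxnC => /F0.
rewrite (minn_idPl jj') (maxn_idPr jj') => F0.
have lt k : (k < j' - j)%N -> ((j + k).+1 < w)%N.
  by move=> kn; apply: leq_ltn_trans (ltn_ord j'); rewrite -addnS -leq_subRL.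
have := @pot_walk_incr R (grid m w) F (grow i j) j (j' - j).
rewrite subnKC // !growE !F0 ?leqnn ?jj' // subrr; apply=> k kn; first exact/grow_adj/lt.
by rewrite /grow !F0 // val_insubd ?lt ?(ltnW (lt _ kn)) //; lia.
Qed.

End Columns.

Lemma grid_walk (R : realType) (p : pricing R (grid m w)) u v :
  exists r, walk p u v r.
Proof.
case: u v => [i j] [i' j'].
have [r1 H1] : exists r, walk p (i, j) (i', j) r.
  wlog ii' : i i' / (i <= i')%N => [IH|].
    by case: (leqP i i') => [|/ltnW] /IH // [r /walk_sym]; exists r.
  eexists; have := @walk_line R (grid m w) p (gcol i j) i (i' - i).
  rewrite subnKC // !gcolE; apply=> k kn; apply: gcol_adj.
  by apply: leq_ltn_trans (ltn_ord i'); rewrite -addnS -leq_subRL.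
have [r2 H2] : exists r, walk p (i', j) (i', j') r.
  wlog jj' : j j' {H1} / (j <= j')%N => [IH|].
    by case: (leqP j j') => [|/ltnW] /IH // [r /walk_sym]; exists r.
  eexists; have := @walk_line R (grid m w) p (grow i' j) j (j' - j).
  rewrite subnKC // !growE; apply=> k kn; apply: grow_adj.
  by apply: leq_ltn_trans (ltn_ord j'); rewrite -addnS -leq_subRL.
by exists (r1 + r2); exact: walk_trans H1 H2.
Qed.

(** A discrete intermediate value argument: an edge changes the row by at most one. *)
Lemma path_crosses_row u s (k : nat) : path (@adj (grid m w)) u s ->
  (u.1 <= k)%N -> (k <= (last u s).1)%N -> has (fun x : grid m w => x.1 == k :> nat) (u :: s).
Proof.
elim: s u => [|x s IH] u /=; first by rewrite orbF => _ ? ?; rewrite eqn_leq; apply/andP.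
move=> /andP[ux xs] uk kl; case: (eqVneq (u.1 : nat) k) => //= uk'.
apply: IH => //; move: ux uk uk'; rewrite /grid_adj /grid_next.
move=> /orP[/orP[]|/orP[]] /andP[/eqP + /eqP +]; case: u {xs kl} => [a b]; case: x => [c d] /=.
- by move=> ->.
- by move=> ->; lia.
- by move=> ->.
- by lia.
Qed.

End Grid.

(** * The candidate pricings and their revenue *)

Definition blk (l i : nat) : nat := (i %/ 2 ^ l)%N.

Lemma blkS l i : blk l.+1 i = (blk l i)./2.
Proof. by rewrite /blk expnSr divnMA divn2. Qed.

Lemma blk_homo l i i' : (i <= i')%N -> (blk l i <= blk l i')%N.
Proof. exact: leq_div2r. Qed.

Lemma blk_ltn l i k : (blk l i < k)%N = (i < k * 2 ^ l)%N.
Proof. by rewrite /blk ltn_divLR ?expn_gt0. Qed.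

Lemma blk_succ l i : (blk l i.+1 <= (blk l i).+1)%N.
Proof.
rewrite -ltnS blk_ltn; have := ltnSn (blk l i); rewrite blk_ltn => H.
rewrite mulSn; have := expn_gt0 2 l; lia.
Qed.

(** The level is the position of the highest binary digit in which [i] and [i'] differ. *)
Lemma ex_level L i i' : i != i' -> (i < 2 ^ L)%N -> (i' < 2 ^ L)%N ->
  exists2 l, (l < L)%N & (blk l i != blk l i') && ((blk l i)./2 == (blk l i')./2).
Proof.
move=> ii' iL i'L.
have : blk L i == blk L i' by rewrite /blk !divn_small.
elim: L {iL i'L} => [|L IH]; first by rewrite /blk !divn1 (negbTE ii').
have [/IH[l lL H] _|nL] := boolP (blk L i == blk L i').
  by exists l => //; exact: ltnW.
by rewrite !blkS => E; exists L; rewrite ?ltnSn // nL.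
Qed.

(** The binary digit of [i] at position [l] tells in which half of its block of 2^(l+1) rows it
    lies. *)
Definition on_side l b i : bool := odd (blk l i) == b.

(* When column c is priced on side b of the level l blocks, u has a price and v,
   in the same block, has none. *)
Definition good m w l b c (u v : grid m w) : bool :=
  [&& u.2 == c :> nat, on_side l b u.1, (blk l u.1)./2 == (blk l v.1)./2
    & (blk l u.1 != blk l v.1) || (v.2 != c :> nat)].

Lemma on_side_sibling l b i i' : (blk l i)./2 = (blk l i')./2 ->
  blk l i != blk l i' -> on_side l b i -> on_side l (~~ b) i'.
Proof.
rewrite /on_side => h; rewrite -{1}[blk l i]odd_double_half.
rewrite -{1}[blk l i']odd_double_half h eqn_add2r => ne /eqP <-.
by case: (odd _) ne => //=; case: (odd _).
Qed.

Definition flip (R : realType) (G : sgraph) (d : driver R G) : driver R G :=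
  Driver (target d) (source d) (budget_ge0 d).

(** Either endpoint may be the priced one, so each driver occurs in both orientations, in the order
    in which a fold over [B] pushes the flipped drivers. *)
Definition orient (R : realType) (G : sgraph) (B : seq (driver R G)) :=
  rev (map (@flip R G) B) ++ B.

Definition cands (R : realType) (G : sgraph) (B : seq (driver R G)) : seq R :=
  0 :: map (@budget R G) B.

(** The contribution of a row depends on its own price alone, so the total is a sum over rows, as
    the dynamic program requires. *)
Definition reward (R : realType) m w l b c (D : seq (driver R (grid m w)))
    (i : nat) (x : R) : R :=
  \sum_(d <- D | [&& (source d).1 == i :> nat, good l b c (source d) (target d)
                   & x <= budget d]) x.

(* Prices have to increase away from the separator, which lies below the priced
   rows when b is false and above them when b is true. *)
Definition stack (b : bool) (m : nat) : seq nat :=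
  if b then rev (iota 0 m) else iota 0 m.

Definition col_pot (R : realType) m w c (f : nat -> R) (x : grid m w) : R :=
  if x.2 == c :> nat then f x.1 else 0.

Definition scenario (R : realType) m w (B : seq (driver R (grid m w)))
    (q : nat * (bool * nat)) : R * (nat * seq (nat * R)) :=
  let: (l, (b, c)) := q in
  let e := argmax (entry0 R) (dp (on_side l b) (1 < w)%N (cands B)
             (reward l b c (orient B)) (stack b m)) in
  (e.1, (c, e.2.2)).

(** The levels run over all l < m, a list read off the unary m; it contains the levels below [L] of
    the upper bound, where L <= m. *)
Definition scenarios m w : seq (nat * (bool * nat)) :=
  [seq (l, bc) | l <- iota 0 m,
                 bc <- [seq (b, c) | b <- [:: false; true], c <- iota 0 w]].

Definition best (R : realType) m w (B : seq (driver R (grid m w))) :=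
  argmax (0, (0%N, [::])) (map (scenario B) (scenarios m w)).

Definition best_pricing (R : realType) m w (B : seq (driver R (grid m w))) :
    pricing R (grid m w) :=
  pot_pricing (col_pot (best B).2.1 (lookup (best B).2.2)).

Lemma mem_stack b m i : (i \in stack b m) = (i < m)%N.
Proof. by rewrite /stack; case: b; rewrite ?mem_rev mem_iota. Qed.

Lemma uniq_stack b m : uniq (stack b m).
Proof. by rewrite /stack; case: b; rewrite ?rev_uniq iota_uniq. Qed.

Lemma climbs_iota (R : realType) (priced : pred nat) (f : nat -> R) a n :
  climbs priced false f (iota a n) <->
  (forall k, (a <= k)%N -> (k.+1 < a + n)%N -> priced k -> f k.+1 <= f k).
Proof.
elim: n a => [|n IH] a /=; first by split=> // _ k; lia.
split=> [/andP[ca /IH cn] k|H].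
  rewrite leq_eqVlt => /orP[/eqP <- lt pa|ak lt]; last by apply: cn; lia.
  by case: n lt ca {IH cn} => [|n]; [lia|rewrite /= pa].
apply/andP; split; last by apply/IH => k ak kn; apply: H; lia.
by case: n H {IH} => [//|n] H /=; apply/implyP; apply: H; lia.
Qed.

Lemma climbs_rev_iota (R : realType) (priced : pred nat) (f : nat -> R) n :
  climbs priced false f (rev (iota 0 n)) <->
  (forall k, (k.+1 < n)%N -> priced k.+1 -> f k <= f k.+1).
Proof.
elim: n => [|n IH]; first by split=> // _ k; lia.
rewrite -[in iota _ _]addn1 iotaD rev_cat /= add0n.
split=> [/andP[cn /IH H] k|H].
  rewrite ltnS leq_eqVlt => /orP[/eqP kn|kn]; last exact: H.
  move: cn; rewrite -kn -[in iota _ _]addn1 iotaD rev_cat /= add0n.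
  by move=> /implyP.
apply/andP; split; last by apply/IH => k kn; apply: H; lia.
case: n H {IH} => [//|n] H; rewrite -[in iota _ _]addn1 iotaD rev_cat /= add0n.
by apply/implyP; apply: H.
Qed.

Lemma climbs_free (R : realType) (priced : pred nat) (f : nat -> R) d :
  climbs priced true f d.
Proof. by elim: d => //= i [|j d] //= ->; rewrite implybT. Qed.

(** * A candidate pricing earns at least its reward *)

Section Soundness.
Variables (R : realType) (m w : nat) (l : nat) (b : bool) (c : nat).
Variable f : nat -> R.
Hypotheses (f0 : forall i, 0 <= f i) (fN : forall i, ~~ on_side l b i -> f i = 0)
  (fc : climbs (on_side l b) (1 < w)%N f (stack b m)).

Let p : pricing R (grid m w) := pot_pricing (col_pot c f).

(** Either [v] lies outside column [c], or it lies in the sibling block, which is on the unpriced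
    side. *)
Lemma good_pot (u v : grid m w) : good l b c u v ->
  col_pot c f u = f u.1 /\ col_pot c f v = 0.
Proof.
case/and4P=> uc su /eqP h; rewrite /col_pot uc.
case: (eqVneq (v.2 : nat) c) => //= _.
by rewrite orbF => ne; split=> //; apply: fN; move: (on_side_sibling h ne su);
  rewrite /on_side; case: (odd _) (b) => [] [].
Qed.

Lemma good_walk_wide (u v : grid m w) : (1 < w)%N -> good l b c u v ->
  walk p u v (f u.1).
Proof.
move=> w1 guv; have [Fu Fv] := good_pot guv.
case: u v guv Fu Fv => [i j] [i' j'] /= guv Fu Fv.
have jc : j = c :> nat by case/and4P: guv => /eqP.
(* The neighbouring column of [c] in the direction of [v]; if [v] is itself in column [c], whichever
   neighbour exists. *)
pose side : nat := if (j' < c)%N then c.-1 else if (c < j')%N then c.+1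
  else if (c.+1 < w)%N then c.+1 else c.-1.
have sw : (side < w)%N by rewrite /side; have := ltn_ord j'; have := ltn_ord j; do !case: ifP; lia.
pose j0 := Ordinal sw.
have F0 k (h : 'I_w) : h != c :> nat -> col_pot c f ((k, h) : grid m w) = 0.
  by rewrite /col_pot /= => /negbTE ->.
have s0 : j0 != c :> nat by rewrite /= /side; have := ltn_ord j; do !case: ifP; lia.
rewrite -[f i]addr0. apply: (@walk_trans R (grid m w) p (i, j0)).
  have adj0 : adj ((i, j) : grid m w) (i, j0).
    rewrite /= /grid_adj /grid_next /= !eqxx /=; rewrite /side; have := ltn_ord j; do !case: ifP; lia.
  apply: walk_le (walk_edge p adj0).
  by rewrite /p /= pot_costE (F0 i j0 s0) subr0 Fu ger0_norm.
rewrite -[0]addr0; apply: (@walk_trans R (grid m w) p (i', j0)).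
  by apply: pot_col0 => k; exact: F0.
(* The last stretch, along the row of [v], can meet column [c] only at [v], where the potential is
   0. *)
apply: pot_row0 => k hk; have [kj'|kj'] := eqVneq k j'; first by rewrite kj'.
apply: F0; move: hk kj'; rewrite -(inj_eq val_inj) /= /side; have := ltn_ord j.
rewrite /minn /maxn; do !case: ifP; lia.
Qed.

Lemma good_walk_thin (u v : grid m w) : w = 1%N -> good l b c u v ->
  walk p u v (f u.1).
Proof.
move=> w1 guv; have [Fu Fv] := good_pot guv.
have/and4P[uc su /eqP h ne] := guv.
have col (x : grid m w) : x.2 = u.2.
  have lt0 k : (k < w)%N -> k = 0%N by lia.
  by apply: ord_inj; rewrite !(lt0 _ (ltn_ord _)).
have vc : v.2 == c :> nat by rewrite col.
have {ne} ne : blk l u.1 != blk l v.1 by move: ne; rewrite vc orbF.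
have sv := on_side_sibling h ne su.
have FE k : col_pot c f ((k, u.2) : grid m w) = f k by rewrite /col_pot /= uc.
have oddE x : on_side l b x -> odd (blk l x) = b by move/eqP.
have EK x : blk l x = (odd (blk l x) + (blk l x)./2.*2)%N by rewrite odd_double_half.
(* The odd half of a block comes after the even half, so [v], on the other side, precedes [u] when
   [b] holds and follows it otherwise. *)
have dir : (b ==> (v.1 < u.1)%N) && (~~ b ==> (u.1 < v.1)%N).
  have dv : odd (blk l v.1) = ~~ b by exact/eqP.
  have du := oddE _ su.
  have /contra hl : (u.1 <= v.1)%N -> (blk l u.1 <= blk l v.1)%N := @blk_homo l _ _.
  have /contra hr : (v.1 <= u.1)%N -> (blk l v.1 <= blk l u.1)%N := @blk_homo l _ _.
  rewrite -!ltnNge in hl hr.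
  have Eu := EK u.1; have Ev := EK v.1; rewrite du dv -h in Eu Ev.
  by case: (b) Eu Ev => /= Eu Ev; rewrite ?andbT; [apply: hl|apply: hr]; rewrite Eu Ev.
have ev : v = (v.1, u.2) by rewrite -(col v); case: (v).
have eu : u = (u.1, u.2) by case: (u).
have between k k' : (k <= k')%N -> (blk l k)./2 = (blk l k')./2 ->
    forall x, (k <= x <= k')%N -> (blk l x)./2 = (blk l k)./2.
  move=> kk' hk x /andP[kx xk']; apply/eqP; rewrite eqn_leq.
  by rewrite [X in _ && X]half_leq ?blk_homo // hk half_leq // blk_homo.
have fc' := fc; rewrite w1 /stack in fc'.
case: b oddE fN dir fc' su sv => /= oddT fT {}dir {}fc' {}su {}sv.
  have vu : (v.1 < u.1)%N by rewrite andbT in dir.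
  apply: walk_sym; rewrite {1}ev {1}eu; have -> : f u.1 = col_pot c f (u.1, u.2) - col_pot c f v.
    by rewrite Fv subr0 FE.
  rewrite {2}ev; apply: pot_col_incr (ltnW vu) _ => k k' vk ku kk'; rewrite !FE.
  have [pk'|nk'] := boolP (on_side l true k').
    by move/climbs_rev_iota: fc'; rewrite kk'; apply; rewrite -kk'.
  (* Within a block of 2^(l+1) rows those on side [true] come last, so before an unpriced row there
     are only unpriced rows. *)
  suff nk : ~~ on_side l true k by rewrite !fT.
  have bt := between _ _ (ltnW vu) (esym h).
  have hh : (blk l k)./2 = (blk l k')./2 by rewrite !bt; lia.
  apply: contra nk' => pk; apply/eqP; have kk : (k <= k')%N by lia.
  have := blk_homo l kk; rewrite [blk l k]EK [blk l k']EK hh (oddT _ pk).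
  by case: (odd (blk l k')) => //=; lia.
have uv : (u.1 < v.1)%N by [].
rewrite ev {1}eu; have -> : f u.1 = col_pot c f (u.1, u.2) - col_pot c f v.
  by rewrite Fv subr0 FE.
rewrite {2}ev; apply: pot_col_decr (ltnW uv) _ => k k' uk kv kk'; rewrite !FE.
have [pk|nk] := boolP (on_side l false k).
  by move/climbs_iota: fc'; rewrite kk'; apply; rewrite -?kk'.
(* The mirror image: the rows on side [false] come first in the block. *)
suff nk' : ~~ on_side l false k' by rewrite !fT.
have bt := between _ _ (ltnW uv) h.
have hh : (blk l k)./2 = (blk l k')./2 by rewrite !bt; lia.
apply: contra nk => pk; apply/eqP; have kk : (k <= k')%N by lia.
have := blk_homo l kk; rewrite [blk l k]EK [blk l k']EK hh (oddT _ pk).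
by case: (odd (blk l k)) => //=; lia.
Qed.

(** An explicit walk gives one inequality, the difference of potentials the other. *)
Lemma good_dist (u v : grid m w) : (0 < w)%N -> good l b c u v -> dist p u v = f u.1.
Proof.
move=> w0 guv; have cn := grid_walk p; apply/eqP; rewrite eq_le; apply/andP; split.
  apply: dist_le => //; case: (ltnP 1 w) => w1; first exact: good_walk_wide.
  by apply: good_walk_thin => //; apply/eqP; rewrite eqn_leq w1.
have [Fu Fv] := good_pot guv.
have := @potential_le _ _ p (col_pot c f) u v _ _ (dist_walk cn u v).
rewrite Fu Fv subr0 ger0_norm //; by apply=> x y _; rewrite /p /= pot_costE.
Qed.

(** Keeps a driver from counting in both orientations: two endpoints in column [c] would lie in
    sibling blocks, hence on opposite sides. *)
Lemma good_asym (u v : grid m w) : good l b c u v -> good l b c v u -> False.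
Proof.
case/and4P=> uc su /eqP h + /and4P[vc sv _ _]; rewrite vc orbF => ne.
have := on_side_sibling h ne su; rewrite /on_side (eqP sv); by case: (b).
Qed.

Lemma reward_total (D : seq (driver R (grid m w))) (g : nat -> R) :
  \sum_(i <- stack b m) reward l b c D i (g i) =
  \sum_(d <- D) if good l b c (source d) (target d) && (g (source d).1 <= budget d)
                then g (source d).1 else 0.
Proof.
have -> : \sum_(i <- stack b m) reward l b c D i (g i) =
          \sum_(i <- iota 0 m) reward l b c D i (g i).
  by rewrite /stack; case: (b) => //; apply: perm_big; rewrite perm_rev.
rewrite -{1}[m]subn0 -/(index_iota 0 m) big_mkord /reward.
under eq_bigr do rewrite big_mkcond.
rewrite exchange_big /=; apply: eq_bigr => d _.
rewrite (bigD1 (source d).1) //= eqxx /= big1 ?addr0 // => i.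
by rewrite eq_sym -(inj_eq val_inj) /= => /negbTE ->.
Qed.

(** A driver counted in some orientation pays exactly the price of its priced endpoint, and is
    counted in that orientation only; all others pay at least 0. *)
Lemma sound_revenue (B : seq (driver R (grid m w))) : (0 < w)%N ->
  \sum_(i <- stack b m) reward l b c (orient B) i (f i) <= revenue p B.
Proof.
move=> w0; rewrite reward_total /orient big_cat /=.
rewrite big_rev big_map -big_split /=.
apply: ler_sum => d _; have cn := grid_walk p; have rd := driver_revenue_ge0 cn d.
rewrite (driver_revenueE cn) in rd *.
case: ifPn => [/andP[g1 b1]|_].
  rewrite dist_sym // (good_dist w0 g1) b1.
  by case: ifPn => [/andP[/(good_asym g1)]//|_]; rewrite addr0.
by case: ifPn => [/andP[g1 b1]|_]; rewrite add0r // (good_dist w0 g1) b1.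
Qed.

End Soundness.

(** * Upper bound on the optimal revenue *)

Lemma ler_sum_all (R : realType) (T : Type) (P : pred T) (s : seq T) (F G : T -> R) :
  all P s -> (forall x, P x -> F x <= G x) -> \sum_(x <- s) F x <= \sum_(x <- s) G x.
Proof.
move=> + FG; elim: s => [|x s IH] /=; first by rewrite !big_nil.
by move=> /andP[Px Ps]; rewrite !big_cons lerD ?FG ?IH.
Qed.

Section Best.
Variables (R : realType) (m w : nat) (B : seq (driver R (grid m w))).

Lemma cands_ge0 : {in cands B, forall x, 0 <= x}.
Proof.
move=> x; rewrite inE => /orP[/eqP ->//|]; move: x; apply/allP.
by elim: B => //= d D ->; rewrite budget_ge0.
Qed.

Lemma all_cands : all (fun d => budget d \in cands B) (orient B).
Proof.
have H : all (fun d => budget d \in cands B) B.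
  rewrite -(all_map (@budget _ _) (mem (cands B))); apply/allP => x xB.
  by rewrite inE /cands inE xB orbT.
by rewrite /orient all_cat all_rev all_map H andbT.
Qed.

Lemma reward0 l b c (D : seq (driver R (grid m w))) i : reward l b c D i 0 = 0 :> R.
Proof. by rewrite /reward big1. Qed.

(** Budgets are candidates, so rounding up to the next candidate keeps every sale and lowers no
    price. *)
Lemma reward_round_up l b c i (x : R) :
  reward l b c (orient B) i x <= reward l b c (orient B) i (round_up (cands B) x).
Proof.
rewrite /reward big_mkcond [leRHS]big_mkcond.
apply: ler_sum_all all_cands _ => d dB; have r0 := round_up_ge0 cands_ge0 (mem_head _ _) x.
case: (boolP (x <= budget d)) => xd; last by rewrite !andbF; case: ifP.
rewrite (round_up_le dB xd); case: ifP => // _.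
exact/round_up_ge/(le_trans xd)/le_max_cands.
Qed.

(** Rounding is monotone and hence respects [climbs]; the rounded prices are candidates, so [dp_opt]
    applies to them. *)
Lemma est_le_best l b c (f : nat -> R) : (l < m)%N -> (c < w)%N ->
  (forall i, 0 <= f i) -> (forall i, ~~ on_side l b i -> f i = 0) ->
  climbs (on_side l b) (1 < w)%N f (stack b m) ->
  \sum_(i <- stack b m) reward l b c (orient B) i (f i) <= (best B).1.
Proof.
move=> lm cw f0 fN fc.
pose g i := if on_side l b i then round_up (cands B) (f i) else 0.
have r0 := round_up_ge0 cands_ge0 (mem_head _ _).
have g0 i : 0 <= g i by rewrite /g; case: ifP.
have gN i : ~~ on_side l b i -> g i = 0 by rewrite /g => /negbTE ->.
have gc : climbs (on_side l b) (1 < w)%N g (stack b m).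
  elim: (stack b m) fc => //= i d IH /andP[ci /IH ->]; rewrite andbT.
  case: d ci {IH} => // j d /implyP ci; apply/implyP => pi.
  move: (ci pi) => /orP[->//|fji]; apply/orP; right.
  by rewrite /g pi; case: ifP => _; [by apply: round_up_homo => //; exact: mem_head|exact: r0].
have gcand : {in stack b m, forall i, on_side l b i -> g i \in cands B}.
  by move=> i _; rewrite /g => ->; apply: round_up_mem; exact: mem_head.
have [e ed [ev _]] := dp_opt (reward := reward l b c (orient B))
  (reward0 l b c (orient B)) g0 gN gc gcand.
apply: le_trans (_ : e.1 <= _).
  apply: le_trans ev; apply: ler_sum => i _; rewrite /g.
  by case: ifPn => [_|/fN ->//]; exact: reward_round_up.
apply: (@le_trans _ _ (scenario B (l, (b, c))).1).
  by rewrite /scenario /= le_argmax // inE ed orbT.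
apply: le_argmax; rewrite inE; apply/orP; right; apply: map_f.
apply/allpairsP; exists (l, (b, c)); split=> //; first by rewrite mem_iota.
by apply/allpairsP; exists (b, c); split=> //; [case: (b)|rewrite mem_iota].
Qed.

Lemma best_le_revenue : (0 < w)%N -> (best B).1 <= revenue (best_pricing B) B.
Proof.
move=> w0; rewrite /best_pricing.
have := argmax_mem (0, (0%N, [::])) (map (scenario B) (scenarios m w)).
rewrite -/(best B) inE => /orP[/eqP ->|/mapP[[l [b c]] _ ->]] /=.
  by apply: sumr_ge0 => d _; apply/driver_revenue_ge0/grid_walk.
set e := argmax _ _.
have [f0 fN fc -> _] : sound (on_side l b) (1 < w)%N (reward l b c (orient B)) (stack b m) e.
  have := argmax_mem (entry0 R) (dp (on_side l b) (1 < w)%N (cands B)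
             (reward l b c (orient B)) (stack b m)).
  rewrite -/e inE => /orP[/eqP -> |].
    by apply: sound0 => i; exact: reward0.
  by apply: dp_sound (uniq_stack b m); [exact: cands_ge0|move=> i; exact: reward0].
apply: sound_revenue => // i ni; apply: fN; by rewrite negb_and ni.
Qed.

End Best.

Section UpperBound.
Variables (R : realType) (m w : nat) (p : pricing R (grid m w)) (i0 : 'I_m).
Let conn := grid_walk p.

(* First row of the upper half of the level l block of i. *)
Definition sep (l i : nat) : nat := ((blk l i)./2.*2.+1 * 2 ^ l)%N.

Lemma sep_even l i : on_side l false i -> (i < sep l i)%N.
Proof.
by move=> /eqP si; rewrite /sep -blk_ltn ltnS -{1}[blk l i]odd_double_half si.
Qed.

Lemma sep_odd l i : on_side l true i -> (sep l i <= i)%N.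
Proof.
by move=> /eqP si; rewrite /sep leqNgt -blk_ltn -{1}[blk l i]odd_double_half si ltnn.
Qed.

(* Distance from (i, c) to the vertex in column j of its separator if k is
   true, of its own row otherwise. *)
Definition root_dist (k : bool) l b (c j : 'I_w) (i : nat) : R :=
  let s := if k then sep l i else i in
  if [&& on_side l b i, (i < m)%N & (s < m)%N]
  then dist p (gcol i0 c i) (gcol i0 j s) else 0.

Lemma root_dist_ge0 k l b c j i : 0 <= root_dist k l b c j i.
Proof. by rewrite /root_dist; case: ifP => // _; exact: dist_ge0. Qed.

Lemma root_dist0 k l b c j i : ~~ on_side l b i -> root_dist k l b c j i = 0.
Proof. by rewrite /root_dist => /negbTE ->. Qed.

Lemma thin_col (j j' : 'I_w) : (w <= 1)%N -> j = j'.
Proof.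
move=> w1; have lt0 k : (k < w)%N -> k = 0%N by lia.
by apply: ord_inj; rewrite !(lt0 _ (ltn_ord _)).
Qed.

(** In a single column a walk from row [a] to row [z] passes through row [x], so the distance splits
    there. *)
Lemma thin_dist_le (c : 'I_w) a x z : (w <= 1)%N -> (a <= x <= z)%N -> (z < m)%N ->
  dist p (gcol i0 c a) (gcol i0 c x) <= dist p (gcol i0 c a) (gcol i0 c z) /\
  dist p (gcol i0 c x) (gcol i0 c z) <= dist p (gcol i0 c a) (gcol i0 c z).
Proof.
move=> w1 /andP[ax xz] zm.
have vE k : (k < m)%N -> (insubd i0 k : nat) = k by move=> km; rewrite val_insubd km.
have [|y /eqP yx ->] := @dist_cut _ _ p conn
  (fun y : grid m w => y.1 == x :> nat) (gcol i0 c a) (gcol i0 c z).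
  by move=> s ps ls; apply: path_crosses_row ps _ _; rewrite ?ls /= vE //; lia.
have -> : y = gcol i0 c x.
  case: y yx => [y1 y2] /= yx; congr (_, _); last exact: thin_col.
  by apply: ord_inj; rewrite yx vE //; lia.
by rewrite lerDl lerDr !dist_ge0.
Qed.

(** With several columns the condition is vacuous. With one, distances to a separator grow away from
    it, and distances within a row vanish. *)
Lemma root_dist_climbs k l b c j :
  climbs (on_side l b) (1 < w)%N (root_dist k l b c j) (stack b m).
Proof.
case: (ltnP 1 w) => w1; first exact: climbs_free.
rewrite (thin_col j c w1).
have d0 y : dist p y y = 0.
  by apply/eqP; rewrite eq_le dist_ge0 // dist_le //; exact: walk_refl.
(* Consecutive blocks have opposite parities, so adjacent rows on the same side share a block and
   hence a separator. *)
have same x : on_side l b x -> on_side l b x.+1 -> blk l x.+1 = blk l x.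
  move=> /eqP sx /eqP sx'; apply/eqP; rewrite eqn_leq (blk_homo l (leqnSn x)) andbT.
  have := blk_succ l x; rewrite leq_eqVlt => /orP[/eqP E|//].
  by move: sx'; rewrite E /= sx; case: (b).
rewrite /stack; case: b same => same.
  apply/climbs_rev_iota => x xm sx'.
  have [sx|/root_dist0 ->] := boolP (on_side l true x); last exact: root_dist_ge0.
  have E : sep l x.+1 = sep l x by rewrite /sep same.
  rewrite /root_dist sx sx' xm (ltnW xm) /= E; case: k; last first.
    by rewrite xm (ltnW xm) !d0.
  case: ifP => // sm; rewrite ![dist p _ (gcol i0 c (sep l x))](dist_sym conn).
  by apply: (thin_dist_le _ w1 _ xm).1; rewrite sep_odd ?leqnSn.
apply/climbs_iota => x _; rewrite add0n => xm sx.
have [sx'|/root_dist0 ->] := boolP (on_side l false x.+1); last exact: root_dist_ge0.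
have E : sep l x.+1 = sep l x by rewrite /sep same.
rewrite /root_dist sx sx' xm (ltnW xm) /= E; case: k; last first.
  by rewrite xm (ltnW xm) !d0.
case: ifP => // sm; apply: (thin_dist_le _ w1 _ sm).2.
by rewrite leqnSn -E ltnW // sep_even.
Qed.

Variables (L : nat) (mL : (m <= 2 ^ L)%N) (L0 : (0 < L)%N).

Let index : finType := (bool * 'I_L * bool * ('I_w * 'I_w))%type.

(** What [d] pays when column [c] is priced by [root_dist]. The index consists of the kind of root,
    the level, the side, and the columns of the source and of the root. *)
Definition share (q : bool * 'I_L * bool * ('I_w * 'I_w)) (d : driver R (grid m w)) : R :=
  let: (k, l, b, (c, j)) := q in
  let f := root_dist k l b c j in
  if good l b c (source d) (target d) && (f (source d).1 <= budget d)
  then f (source d).1 else 0.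

Lemma share_ge0 q d : 0 <= share q d.
Proof.
by case: q => [[[k l] b] [c j]] /=; case: ifP => // _; exact: root_dist_ge0.
Qed.

Lemma share_le_sum q d : share q d <= \sum_(q : index) share q d.
Proof.
by rewrite (bigD1 q) //= lerDl sumr_ge0 // => q' _; exact: share_ge0.
Qed.

Lemma gcol_id (u : grid m w) : gcol i0 u.2 u.1 = u.
Proof. by case: u => [a b]; exact: gcolE. Qed.

(** For endpoints in different rows the distance splits at a separator into two parts, each within
    the budget; one is a share of [d], the other a share of [flip d]. *)
Lemma driver_revenue_le d : driver_revenue p d <=
  \sum_(q : index) share q d + \sum_(q : index) share q (flip d).
Proof.
have A0 d' : 0 <= \sum_(q : index) share q d' by apply: sumr_ge0 => q _; exact: share_ge0.
rewrite (driver_revenueE conn); case: ifPn => [sold|_]; last exact: addr_ge0.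
set u := source d in sold *; set v := target d in sold *.
have [uv1|uv1] := eqVneq u.1 v.1.
  apply: le_trans (_ : \sum_(q : index) share q d <= _); last by rewrite lerDl.
  have [uv2|uv2] := eqVneq u.2 v.2.
    have -> : u = v by case: (u) (v) uv1 uv2 => [a b] [a' b'] /= -> ->.
    exact: le_trans (dist_le conn (walk_refl p v)) (A0 d).
  (* In a common row the target itself is the root, and one share at level 0 pays the whole
     distance. *)
  apply: le_trans (share_le_sum (false, Ordinal L0, odd (blk 0 u.1), (u.2, v.2)) d).
  have E : root_dist false 0 (odd (blk 0 u.1)) u.2 v.2 u.1 = dist p u v.
    by rewrite /root_dist /on_side eqxx !ltn_ord /= gcol_id uv1 gcol_id.
  rewrite /= -/u -/v E sold andbT /good /on_side uv1 !eqxx /=.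
  by rewrite -(inj_eq val_inj) /= eq_sym in uv2; rewrite uv2.
have [] := @ex_level L u.1 v.1; rewrite ?(leq_trans (ltn_ord _) mL) //.
move=> l lL /andP[ne /eqP hl].
have sE : sep l v.1 = sep l u.1 by rewrite /sep hl.
pose s := sep l u.1.
have [z zs Ez] : exists2 z : grid m w, z.1 == s :> nat & dist p u v = dist p u z + dist p z v.
  (* The walk is read from the endpoint with the smaller row, since [path_crosses_row] needs
     ascending row numbers. *)
  case: (boolP (on_side l false u.1)) => su.
    have sv := on_side_sibling hl ne su.
    apply: dist_cut => // t pt lt; apply: path_crosses_row pt _ _.
      exact/ltnW/sep_even.
    by rewrite lt /s -sE sep_odd.
  have {}su : on_side l true u.1 by move: su; rewrite /on_side; case: (odd _).
  have sv := on_side_sibling hl ne su.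
  rewrite (dist_sym conn u).
  have [|z zs E] := @dist_cut _ _ p conn (fun z : grid m w => z.1 == s :> nat) v u.
    move=> t pt lt; apply: path_crosses_row pt _ _; last by rewrite lt sep_odd.
    by rewrite /s -sE; apply/ltnW/sep_even.
  by exists z; rewrite // E addrC (dist_sym conn v z) (dist_sym conn u z).
have zE : gcol i0 z.2 s = z by rewrite -(eqP zs) gcol_id.
have sm : (s < m)%N by rewrite -(eqP zs) ltn_ord.
rewrite {1}Ez; apply: lerD.
  apply: le_trans (share_le_sum (true, Ordinal lL, odd (blk l u.1), (u.2, z.2)) d).
  have E : root_dist true l (odd (blk l u.1)) u.2 z.2 u.1 = dist p u z.
    by rewrite /root_dist /on_side eqxx ltn_ord sm /= gcol_id -/s zE.
  rewrite /= -/u -/v E /good /on_side !eqxx hl ne eqxx /=.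
  by rewrite (le_trans _ sold) // Ez lerDl dist_ge0.
apply: le_trans (share_le_sum (true, Ordinal lL, odd (blk l v.1), (v.2, z.2)) (flip d)).
have E : root_dist true l (odd (blk l v.1)) v.2 z.2 v.1 = dist p v z.
  by rewrite /root_dist /on_side eqxx ltn_ord sE sm /= gcol_id -/s zE.
rewrite /= -/u -/v E /good /on_side !eqxx hl eq_sym ne eqxx /=.
rewrite (dist_sym conn z); case: ifP => //; rewrite (dist_sym conn v).
by rewrite (le_trans _ sold) // Ez lerDr dist_ge0.
Qed.

Lemma revenue_le_best B : (L <= m)%N -> revenue p B <= (4 * L * w ^ 2)%:R * (best B).1.
Proof.
move=> Lm; apply: (@le_trans _ _ (\sum_(q : index) (best B).1)); last first.
  (* There are 2 kinds of root, [L] levels, 2 sides and w^2 pairs of columns. *)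
  rewrite big_const iter_addr addr0 mulr_natl !card_prod !card_ord card_bool.
  by rewrite le_eqVlt; apply/orP; left; apply/eqP; congr (_ *+ _); lia.
apply: le_trans (_ : \sum_(d <- orient B) \sum_(q : index) share q d <= _).
  rewrite /orient big_cat /= big_rev big_map -big_split /=.
  by apply: ler_sum => d _; rewrite addrC driver_revenue_le.
rewrite exchange_big /=; apply: ler_sum => [[[[k l] b] [c j]]] _ /=.
rewrite -(reward_total l b c (orient B) (root_dist k l b c j)).
apply: est_le_best => //; last exact: root_dist_climbs.
- exact: leq_trans (ltn_ord l) Lm.
- by move=> i; exact: root_dist_ge0.
- by move=> i; exact: root_dist0.
Qed.

End UpperBound.

(** * The logarithmic approximation ratio *)

Lemma half_le_ln2 (R : realType) : 2^-1 <= ln (2 : R).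
Proof.
(* The inequality ln(1+x) <= x at x = -1/2. *)
have := @le_ln1Dx R (- 2^-1); rewrite (_ : 1 + - 2^-1 = 2^-1 :> R); last by lra.
by rewrite lnV ?posrE //; lra.
Qed.

(** Both [trunc_log 2 m] and 1 are at most 2 ln(m+1), because ln 2 >= 1/2. *)
Lemma trunc_log_le_ln (R : realType) m : (0 < m)%N ->
  (trunc_log 2 m).+1%:R <= 4 * ln (m.+1%:R : R).
Proof.
move=> m0; have h2 := half_le_ln2 R.
have l1 : ln (2 : R) <= ln (m.+1%:R : R).
  by rewrite ler_ln ?posrE ?ltr0n // ler_nat.
have l2 : (trunc_log 2 m)%:R * ln (2 : R) <= ln (m.+1%:R : R).
  rewrite mulr_natl -lnXn // ler_ln ?posrE ?exprn_gt0 ?ltr0n // -natrX ler_nat.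
  by rewrite (leq_trans (trunc_logP _ m0)).
rewrite -natr1; have t0 : 0 <= (trunc_log 2 m)%:R :> R by [].
have : (trunc_log 2 m)%:R * 2^-1 <= ln (m.+1%:R : R).
  by apply: le_trans l2; rewrite ler_wpM2l.
lra.
Qed.

Lemma OPT_le (R : realType) m w (B : seq (driver R (grid m w))) :
  (0 < m)%N -> (0 < w)%N ->
  OPT B <= (16 * w ^ 2)%:R * ln (m.+1)%:R * revenue (best_pricing B) B.
Proof.
move=> m0 w0; apply: ge_sup; first by exists (revenue (best_pricing B) B), (best_pricing B).
(* With this [L], 2^(L-1) <= m < 2^L, so [L] levels separate all rows, and L <= m. *)
move=> _ [p _ <-]; pose L := (trunc_log 2 m).+1.
have mL : (m <= 2 ^ L)%N by rewrite ltnW // trunc_log_ltn.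
have Lm : (L <= m)%N by apply: leq_trans (@trunc_logP 2 m isT m0); apply: ltn_expl.
have br := best_le_revenue B w0.
have b0 : 0 <= (best B).1.
  exact: (@le_argmax _ _ (0, (0%N, [::])) _ (0, (0%N, [::])) (mem_head _ _)).
apply: le_trans (revenue_le_best p (Ordinal m0) mL isT B Lm) _.
apply: ler_pM => //.
have := trunc_log_le_ln R m0; rewrite -/L => lL.
rewrite !natrM; have : (0 : R) <= (w ^ 2)%:R by [].
by move=> w20; rewrite [leRHS]mulrAC ler_wpM2r //; lra.
Qed.

(** * Basic programs *)

Lemma vlist_enc_seq (R : Type) (s : seq (tree R)) : vlist (enc_seq s) = s.
Proof. by elim: s => //= h s ->. Qed.

(** Value and length bounds are proved together, with one rule per constructor. *)
Definition ev (R : realType) (N : nat) (f : fn) (v o : tree R) : Prop :=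
  run f v = o /\ safe N f v.

Definition enc_bool (R : Type) (b : bool) : tree R :=
  if b then VPair VNil VNil else VNil.
Arguments enc_bool {R} b.

Section Eval.
Variables (R : realType) (N : nat).
Implicit Types (v o u : tree R) (f g : fn).

Lemma evE e v : ev N (FE e) v (teval (fun=> v) e).
Proof. by []. Qed.

Lemma evC u f g v o : ev N f v u -> ev N g u o -> ev N (FC g f) v o.
Proof. by move=> [Ef sf] [Eg sg]; rewrite /ev /= Ef. Qed.

Lemma evP f g v o o' : ev N f v o -> ev N g v o' -> ev N (FP f g) v (VPair o o').
Proof. by move=> [Ef sf] [Eg sg]; rewrite /ev /= Ef Eg. Qed.

Lemma evIt u c f g v o : ev N c v u ->
  ev N (if truth u then f else g) v o -> ev N (FI c f g) v o.
Proof. by move=> [Ec sc]; rewrite /ev /= Ec; case: (truth u) => -[Eg sg]. Qed.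

Lemma evI b c f g v o : ev N c v (enc_bool b) ->
  ev N (if b then f else g) v o -> ev N (FI c f g) v o.
Proof. by move=> [Ec sc]; rewrite /ev /= Ec; case: b {Ec} => -[Eg sg]. Qed.

(** Transfers a mathematical fold to encodings; [PA] and [PT] carry invariants of elements and
    accumulators, such as size bounds. *)
Lemma evL (A T : Type) (encA : A -> tree R) (encT : T -> tree R)
    (PA : pred A) (PT : pred T) (h : T -> A -> T) l i st v s t0 :
  ev N l v (enc_seq (map encA s)) -> ev N i v (encT t0) -> (size s <= N)%N ->
  all PA s -> PT t0 ->
  (forall a t, PA a -> PT t ->
     ev N st (VPair (encA a) (VPair (encT t) v)) (encT (h t a)) /\ PT (h t a)) ->
  ev N (FL l i st) v (encT (foldl h t0 s)).
Proof.
move=> [El sl] [Ei si] sN As P0 H; rewrite /ev /= El Ei vlist_enc_seq size_map.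
suff [E S] : foldl (fun acc x => run st (VPair x (VPair acc v))) (encT t0) (map encA s)
    = encT (foldl h t0 s) /\
  all_steps (fun acc x => safe N st (VPair x (VPair acc v)))
            (fun acc x => run st (VPair x (VPair acc v))) (encT t0) (map encA s).
  by split.
elim: s t0 P0 As {El Ei sN} => //= a s IH t P /andP[Pa Ps].
by have [[-> sa] P'] := H a t Pa P; have [-> ss] := IH _ P' Ps.
Qed.

End Eval.

Local Notation arg := (EVar 0).
(* The step of a fold is applied to (head, (accumulator, input of the fold)). *)
Local Notation "'hd" := (EFst arg).
Local Notation "'ac" := (EFst (ESnd arg)).
Local Notation "'cx" := (ESnd (ESnd arg)).
Local Notation etrue := (EPair ENil ENil).

Definition f_rev : fn := FL (FE arg) (FE ENil) (FE (EPair 'hd 'ac)).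

(** The fold builds its result back to front, hence the final reversal. *)
Definition f_map (l g : fn) : fn :=
  FC f_rev (FL l (FE ENil) (FP (FC g (FE (EPair 'hd 'cx))) (FE 'ac))).

Definition f_filter (l g : fn) : fn :=
  FC f_rev (FL l (FE ENil)
    (FI (FC g (FE (EPair 'hd 'cx))) (FE (EPair 'hd 'ac)) (FE 'ac))).

Definition f_pairs (l1 l2 : fn) : fn :=
  FC f_rev (FL l1 (FE ENil)
    (FL (FC l2 (FE 'cx)) (FE 'ac) (FE (EPair (EPair (EFst 'cx) 'hd) 'ac)))).

Definition f_and (f g : fn) : fn := FI f g (FE ENil).
Definition f_not (f : fn) : fn := FI f (FE ENil) (FE etrue).
Definition f_or (f g : fn) : fn := FI f (FE etrue) g.

(** Equality by unary subtraction: each unit of the first number removes one from the second, and a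
    flag records whether the second ran out. Equality holds if the flag is intact and nothing
    remains. *)
Definition f_eq : fn :=
  FC (FI (FE (EFst arg)) (FE ENil) (FE (ESnd arg)))
     (FL (FE (EFst arg)) (FE (EPair (ESnd arg) etrue))
       (FI (FE (EFst 'ac)) (FE (EPair (ESnd (EFst 'ac)) (ESnd 'ac)))
           (FE (EPair ENil ENil)))).

(** The flag toggles at each unit and the counter grows at every second one, which yields parity and
    half. *)
Definition f_half : fn :=
  FL (FE arg) (FE (EPair ENil ENil))
     (FI (FE (EFst 'ac)) (FE (EPair ENil (EPair ENil (ESnd 'ac))))
         (FE (EPair etrue (ESnd 'ac)))).

Definition f_blk : fn :=
  FL (FE (EFst arg)) (FE (ESnd arg)) (FC (FE (ESnd arg)) (FC f_half (FE 'ac))).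

Definition f_max (l i : fn) : fn :=
  FL l i (FI (FE (ELe (EFst 'hd) (EFst 'ac))) (FE 'ac) (FE 'hd)).

Section Basics.
Variables (R : realType) (N : nat).
Implicit Types (v o u : tree R) (f g : fn).

Lemma ev_rev (s : seq (tree R)) : (size s <= N)%N ->
  ev N f_rev (enc_seq s) (enc_seq (rev s)).
Proof.
move=> sN; have -> : rev s = foldl (fun t a => a :: t) [::] s.
  rewrite -[LHS]cats0; elim: s [::] {sN} => //= a s IH t.
  by rewrite rev_cons cat_rcons IH.
apply: (@evL _ _ _ _ id (@enc_seq R) predT predT) => //; rewrite ?map_id //.
by rewrite all_predT.
Qed.

Lemma ev_map (A B : Type) (encA : A -> tree R) (encB : B -> tree R) (P : pred A)
    (h : A -> B) l g v s :
  ev N l v (enc_seq (map encA s)) -> (size s <= N)%N -> all P s ->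
  (forall a, P a -> ev N g (VPair (encA a) v) (encB (h a))) ->
  ev N (f_map l g) v (enc_seq [seq encB (h a) | a <- s]).
Proof.
move=> el sN Ps H; rewrite -[Z in enc_seq Z]revK.
apply: evC (ev_rev _); last by rewrite size_rev size_map.
have -> : rev [seq encB (h a) | a <- s] = foldl (fun t a => encB (h a) :: t) [::] s.
  rewrite -[LHS]cats0; elim: s [::] {el sN Ps} => //= a s IH t.
  by rewrite rev_cons cat_rcons IH.
apply: (@evL _ _ _ _ encA (@enc_seq R) P predT) => // a t Pa _; split=> //.
apply: (@evP _ _ _ _ _ (encB (h a)) (enc_seq t)); last exact: evE.
by apply: evC (H a Pa); exact: evE.
Qed.

Lemma ev_filter (A : Type) (encA : A -> tree R) (P : pred A)
    (h : A -> bool) l g v s :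
  ev N l v (enc_seq (map encA s)) -> (size s <= N)%N -> all P s ->
  (forall a, P a -> ev N g (VPair (encA a) v) (enc_bool (h a))) ->
  ev N (f_filter l g) v (enc_seq [seq encA a | a <- s & h a]).
Proof.
move=> el sN Ps H; rewrite -[Z in enc_seq Z]revK.
apply: evC (ev_rev _); last first.
  by rewrite size_rev size_map size_filter (leq_trans (count_size _ _)).
have -> : rev [seq encA a | a <- s & h a] =
    foldl (fun t a => if h a then encA a :: t else t) [::] s.
  rewrite -[LHS]cats0; elim: s [::] {el sN Ps} => //= a s IH t.
  by case: (h a) => //=; rewrite rev_cons cat_rcons IH.
apply: (@evL _ _ _ _ encA (@enc_seq R) P predT) => // a t Pa _; split=> //.
apply: (@evI _ _ (h a)); first by apply: evC (H a Pa); exact: evE.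
by case: (h a); exact: evE.
Qed.

Lemma ev_pairs (A B : Type) (encA : A -> tree R) (encB : B -> tree R) l1 l2 v s t :
  ev N l1 v (enc_seq (map encA s)) -> ev N l2 v (enc_seq (map encB t)) ->
  (size s <= N)%N -> (size t <= N)%N -> (size s * size t <= N)%N ->
  ev N (f_pairs l1 l2) v (enc_seq
    [seq VPair (encA xy.1) (encB xy.2) | xy <- [seq (x, y) | x <- s, y <- t]]).
Proof.
move=> e1 e2 sN tN stN; rewrite -[Z in enc_seq Z]revK.
apply: evC (ev_rev _); last by rewrite size_rev size_map size_allpairs.
have -> : rev [seq VPair (encA xy.1) (encB xy.2) | xy <- [seq (x, y) | x <- s, y <- t]] =
    foldl (fun acc x => foldl (fun acc y => VPair (encA x) (encB y) :: acc) acc t) [::] s.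
  rewrite -[LHS]cats0; elim: s [::] {e1 sN stN} => //= x s IH acc.
  rewrite map_cat rev_cat -catA IH -map_comp; congr foldl.
  elim: t acc {e2 tN IH} => //= y t IH acc.
  by rewrite rev_cons cat_rcons IH.
apply: (@evL _ _ _ _ encA (@enc_seq R) predT predT); rewrite ?all_predT //.
move=> x acc _ _; split=> //.
apply: (@evL _ _ _ _ encB (@enc_seq R) predT predT); rewrite ?all_predT //.
by apply: evC e2; exact: evE.
Qed.

Lemma ev_and a b f g v : ev N f v (enc_bool a) -> ev N g v (enc_bool b) ->
  ev N (f_and f g) v (enc_bool (a && b)).
Proof. by move=> ef eg; apply: evI ef _; case: a => //; exact: evE. Qed.

Lemma ev_not a f v : ev N f v (enc_bool a) -> ev N (f_not f) v (enc_bool (~~ a)).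
Proof. by move=> ef; apply: evI ef _; case: a; exact: evE. Qed.

Lemma ev_or a b f g v : ev N f v (enc_bool a) -> ev N g v (enc_bool b) ->
  ev N (f_or f g) v (enc_bool (a || b)).
Proof. by move=> ef eg; apply: evI ef _; case: a => //; exact: evE. Qed.

Lemma enc_natE n : enc_nat R n = enc_seq (map (fun=> VNil) (nseq n tt)).
Proof. by rewrite map_nseq. Qed.

Lemma ev_eq x y : (x <= N)%N ->
  ev N f_eq (VPair (enc_nat R x) (enc_nat R y)) (enc_bool (x == y)).
Proof.
move=> xN.
pose h (t : nat * bool) (_ : unit) := if t.1 is y'.+1 then (y', t.2) else (0%N, false).
pose encT (t : nat * bool) : tree R := VPair (enc_nat R t.1) (enc_bool t.2).
have hE : foldl h (y, true) (nseq x tt) = ((y - x)%N, (x <= y)%N).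
  have -> : (x <= y)%N = true && (x <= y)%N by [].
  elim: x (y) true {xN} => [|x IH] z b /=; first by rewrite subn0 andbT.
  by case: z => [|z]; rewrite /h /= -/h IH ?subSS // !sub0n andbF.
apply: (@evC _ _ (encT ((y - x)%N, (x <= y)%N))).
  rewrite -hE; apply: (@evL _ _ _ _ (fun=> VNil) encT predT predT).
  - by rewrite -enc_natE; exact: evE.
  - exact: evE.
  - by rewrite size_nseq.
  - by rewrite all_predT.
  - by [].
  - move=> u [z b] _ _; split=> //; apply: (@evIt _ _ (enc_nat R z)); first exact: evE.
    by case: z => [|z]; exact: evE.
apply: (@evIt _ _ (enc_nat R (y - x)%N)); first exact: evE.
have -> : truth (enc_nat R (y - x)%N) = (x < y)%N by rewrite -subn_gt0; case: (y - x)%N.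
by rewrite eqn_leq [(y <= x)%N]leqNgt; case: ltnP => _; rewrite ?andbF ?andbT; exact: evE.
Qed.

Lemma ev_half x : (x <= N)%N ->
  ev N f_half (enc_nat R x) (VPair (enc_bool (odd x)) (enc_nat R x./2)).
Proof.
move=> xN.
pose h (t : bool * nat) (_ : unit) := if t.1 then (false, t.2.+1) else (true, t.2).
pose encT (t : bool * nat) : tree R := VPair (enc_bool t.1) (enc_nat R t.2).
have hE : foldl h (false, 0%N) (nseq x tt) = (odd x, x./2).
  have H n : foldl h (false, n) (nseq x tt) = (odd x, x./2 + n)%N.
    elim/ltn_ind: x n {xN} => [[|[|x]]] IH n //=.
    by rewrite IH // negbK /= addnS addSn.
  by rewrite H addn0.
rewrite -[VPair _ _]/(encT (odd x, x./2)) -hE.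
apply: (@evL _ _ _ _ (fun=> VNil) encT predT predT).
- by rewrite -enc_natE; exact: evE.
- exact: evE.
- by rewrite size_nseq.
- by rewrite all_predT.
- by [].
- move=> u [b n] _ _; split=> //; apply: (@evI _ _ b); first exact: evE.
  by case: b; exact: evE.
Qed.

Lemma ev_blk l x : (l <= N)%N -> (x <= N)%N ->
  ev N f_blk (VPair (enc_nat R l) (enc_nat R x)) (enc_nat R (blk l x)).
Proof.
move=> lN xN; have -> : blk l x = foldl (fun y (_ : unit) => y./2) x (nseq l tt).
  elim: l x {lN xN} => [|l IH] x /=; first by rewrite /blk divn1.
  by rewrite -IH /blk expnS divnMA divn2.
apply: (@evL _ _ _ _ (fun=> VNil) (enc_nat R) predT (fun y => y <= N)%N).
- by rewrite -enc_natE; exact: evE.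
- exact: evE.
- by rewrite size_nseq.
- by rewrite all_predT.
- by [].
- move=> u y _ yN; split; last by rewrite (leq_trans _ yN) // -divn2 leq_div.
  apply: (@evC _ _ (VPair (enc_bool (odd y)) (enc_nat R y./2))); last exact: evE.
  by apply: evC (ev_half yN); exact: evE.
Qed.

Lemma ev_max (T : eqType) (encT : T -> tree R) l i v (a0 : R * T) s :
  let encE (e : R * T) := VPair (VReal e.1) (encT e.2) in
  ev N l v (enc_seq (map encE s)) -> ev N i v (encE a0) -> (size s <= N)%N ->
  ev N (f_max l i) v (encE (argmax a0 s)).
Proof.
move=> encE el ei sN; apply: (@evL _ _ _ _ encE encE predT predT) => //.
  by rewrite all_predT.
move=> e a _ _; split=> //; apply: (@evI _ _ (e.1 <= a.1)); first exact: evE.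
by case: ifP => _; exact: evE.
Qed.

End Basics.

(** * The program for the best candidate *)

Definition f_side : fn :=
  let b := EFst (ESnd (EFst arg)) in
  FI (FC (FE (EFst arg)) (FC f_half
       (FC f_blk (FE (EPair (EFst (EFst arg)) (ESnd arg))))))
     (FE b) (f_not (FE b)).

Definition f_good : fn :=
  let u := EFst (ESnd arg) in
  let v := ESnd (ESnd arg) in
  let c := ESnd (ESnd (EFst arg)) in
  let b z := FC f_blk (FE (EPair (EFst (EFst arg)) (EFst z))) in
  let h z := FC (FE (ESnd arg)) (FC f_half (b z)) in
  f_and (FC f_eq (FE (EPair (ESnd u) c)))
  (f_and (FC f_side (FE (EPair (EFst arg) (EFst u))))
  (f_and (FC f_eq (FP (h u) (h v)))
  (f_or (f_not (FC f_eq (FP (b u) (b v))))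
        (f_not (FC f_eq (FE (EPair (ESnd v) c))))))).

Definition f_reward : fn :=
  let x := ESnd (ESnd 'cx) in
  FL (FE (ESnd (EFst arg))) (FE (EReal 0))
    (FI (f_and (FC f_eq (FE (EPair (EFst (EFst (EFst 'hd))) (EFst (ESnd 'cx)))))
        (f_and (FC f_good (FE (EPair (EFst (EFst 'cx)) (EFst 'hd))))
               (FE (ELe x (ESnd 'hd)))))
      (FE (EAdd 'ac x)) (FE 'ac)).

Definition e_entry0 : expr := EPair (EReal 0) (EPair (EReal 0) ENil).

(** The argument is (candidate, (context, (row, entries))), with context (scenario, (drivers,
    candidates)). The outer expression receives (best predecessor, (reward, argument)). *)
Definition f_new (free : bool) : fn :=
  let s := ESnd arg in
  let x := EFst (ESnd (ESnd arg)) in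
  FC (FE (EPair (EAdd (EFst (EFst arg)) (EFst (ESnd arg)))
       (EPair x (EPair (EPair (EFst (ESnd (ESnd (ESnd (ESnd arg))))) x)
                       (ESnd (ESnd (EFst arg)))))))
  (FP (f_max (f_filter (FE (ESnd (ESnd s)))
         (FE (if free then etrue
              else ELe (EFst (ESnd (EFst arg))) (EFst (ESnd arg)))))
       (FE e_entry0))
  (FP (FC f_reward (FE (EPair (EPair (EFst (EFst s)) (EFst (ESnd (EFst s))))
                              (EPair (EFst (ESnd s)) (EFst arg)))))
      (FE arg))).

Definition f_step (free : bool) : fn :=
  FI (FC f_side (FE (EPair (EFst (EFst arg)) (EFst (ESnd arg)))))
    (f_map (FE (ESnd (ESnd (EFst arg)))) (f_new free))
    (FC (FE (EPair (EPair (EFst arg) (EPair (EReal 0) (ESnd (ESnd arg)))) ENil))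
        (f_max (FE (ESnd (ESnd arg))) (FE e_entry0))).

(** [dp] folds from the right and the program from the left, so the stack is supplied in reverse. *)
Definition f_dp (free : bool) : fn :=
  FL (FE (ESnd arg)) (FE (EPair e_entry0 ENil))
     (FC (f_step free) (FE (EPair (EFst 'cx) (EPair 'hd 'ac)))).

(** The rows are supplied in both orders; the reversed stack is the ascending one when the side is
    [true]. *)
Definition f_scenario (free : bool) : fn :=
  let s := ESnd (ESnd (ESnd arg)) in
  FC (FE (EPair (EFst (EFst arg))
       (EPair (ESnd (ESnd (EFst (ESnd arg)))) (ESnd (ESnd (EFst arg))))))
  (FP (f_max (FC (f_dp free)
         (FP (FE (EPair (EFst arg) (EPair (EFst (ESnd arg)) (EFst (ESnd (ESnd arg))))))
             (FI (FE (EFst (ESnd (EFst arg)))) (FE (EFst s)) (FE (ESnd s)))))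
       (FE e_entry0))
      (FE arg)).

Definition e_nat (n : nat) : expr := iter n (EPair ENil) ENil.
(** The width is fixed, so the list of columns is a constant of the program. *)
Definition e_cols (w : nat) : expr := foldr EPair ENil (map e_nat (iota 0 w)).

Definition f_best (w : nat) : fn :=
  f_max (f_map (f_pairs (FE (EFst (ESnd (ESnd arg))))
                  (f_pairs (FE (EPair ENil (EPair etrue ENil))) (FE (e_cols w))))
           (f_scenario (1 < w)%N))
        (FE (EPair (EReal 0) (EPair ENil ENil))).

Definition enc_wit (R : realType) (t : seq (nat * R)) : tree R :=
  enc_seq [seq VPair (enc_nat R e.1) (VReal e.2) | e <- t].

Definition enc_data (R : realType) (e : R * seq (nat * R)) : tree R :=
  VPair (VReal e.1) (enc_wit e.2).

Definition enc_entry (R : realType) (e : entry R) : tree R :=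
  VPair (VReal e.1) (enc_data e.2).

Definition enc_sol (R : realType) (e : nat * seq (nat * R)) : tree R :=
  VPair (enc_nat R e.1) (enc_wit e.2).

Definition enc_scenario (R : realType) (q : nat * (bool * nat)) : tree R :=
  VPair (enc_nat R q.1) (VPair (enc_bool q.2.1) (enc_nat R q.2.2)).

(** * Correctness of the search for the best candidate *)

Section Programs.
Variables (R : realType) (N m w : nat).
Hypotheses (mN : (m <= N)%N) (wN : (w <= N)%N).

Lemma row_le (u : grid m w) : (u.1 <= N)%N.
Proof. by apply: ltnW; apply: leq_trans mN; exact: ltn_ord. Qed.

Lemma col_le (u : grid m w) : (u.2 <= N)%N.
Proof. by apply: ltnW; apply: leq_trans wN; exact: ltn_ord. Qed.

Lemma blk_le l i : (blk l i <= i)%N.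
Proof. exact: leq_div. Qed.

Lemma ev_side l b c i : (l <= N)%N -> (i <= N)%N ->
  ev N f_side (VPair (enc_scenario R (l, (b, c))) (enc_nat R i)) (enc_bool (on_side l b i)).
Proof.
move=> lN iN; apply: (@evI _ _ (odd (blk l i))).
  apply: (@evC _ _ (VPair (enc_bool (odd (blk l i))) (enc_nat R (blk l i)./2))); last exact: evE.
  apply: (@evC _ _ (enc_nat R (blk l i))); last first.
    by apply: ev_half; exact: leq_trans (blk_le _ _) iN.
  by apply: evC (ev_blk _ lN iN); exact: evE.
rewrite /on_side; case: (odd _); first by rewrite eq_sym eqb_id; exact: evE.
by rewrite eq_sym eqbF_neg; apply: ev_not; exact: evE.
Qed.

Lemma ev_good l b c (u v : grid m w) : (l <= N)%N ->
  ev N f_good (VPair (enc_scenario R (l, (b, c))) (VPair (enc_vertex R u) (enc_vertex R v)))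
    (enc_bool (good l b c u v)).
Proof.
move=> lN.
have vN x (z : grid m w) : (blk x z.1 <= N)%N by exact: leq_trans (blk_le _ _) (row_le z).
have hN x (z : grid m w) : ((blk x z.1)./2 <= N)%N.
  by apply: leq_trans (vN x z); rewrite -divn2 leq_div.
apply: ev_and; first by apply: evC (ev_eq _ _ (col_le u)); exact: evE.
apply: ev_and; first by apply: evC (ev_side b c lN (row_le u)); exact: evE.
apply: ev_and.
  apply: evC (ev_eq _ _ (hN l u)); apply: evP.
    apply: (@evC _ _ (VPair (enc_bool (odd (blk l u.1))) (enc_nat R (blk l u.1)./2))); last exact: evE.
    by apply: evC (ev_half _ (vN l u)); apply: evC (ev_blk _ lN (row_le u)); exact: evE.
  apply: (@evC _ _ (VPair (enc_bool (odd (blk l v.1))) (enc_nat R (blk l v.1)./2))); last exact: evE.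
  by apply: evC (ev_half _ (vN l v)); apply: evC (ev_blk _ lN (row_le v)); exact: evE.
apply: ev_or; apply: ev_not; last by apply: evC (ev_eq _ _ (col_le v)); exact: evE.
apply: evC (ev_eq _ _ (vN l u)); apply: evP.
  by apply: evC (ev_blk _ lN (row_le u)); exact: evE.
by apply: evC (ev_blk _ lN (row_le v)); exact: evE.
Qed.

Section Instance.
Variables (l : nat) (b : bool) (c : nat) (D : seq (driver R (grid m w))) (C : seq R).
Hypotheses (lN : (l <= N)%N) (DN : (size D <= N)%N) (CN : (0 < size C <= N)%N).

Let sc : tree R := enc_scenario R (l, (b, c)).
Let eD : tree R := enc_seq (map (@enc_driver R m w) D).
Let eC : tree R := enc_seq (map (@VReal R) C).

Lemma ev_reward i x : (i <= N)%N ->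
  ev N f_reward (VPair (VPair sc eD) (VPair (enc_nat R i) (VReal x)))
    (VReal (reward l b c D i x)).
Proof.
move=> iN.
pose h (a : R) (d : driver R (grid m w)) :=
  if [&& (source d).1 == i :> nat, good l b c (source d) (target d) & x <= budget d]
  then a + x else a.
have -> : reward l b c D i x = foldl h 0 D.
  suff H s a : foldl h a s = a + reward l b c s i x by rewrite H add0r.
  rewrite /reward; elim: s a => [|d s IH] a; first by rewrite big_nil addr0.
  by rewrite big_cons /= IH /h; case: ifP => // _; rewrite addrA.
apply: (@evL _ _ _ _ (@enc_driver R m w) (@VReal R) predT predT).
- exact: evE.
- by split=> //=; rewrite rmorph0.
- exact: DN.
- by rewrite all_predT.
- by [].
move=> d a _ _; split=> //; apply: evI; first apply: ev_and.
- by apply: evC (ev_eq _ _ (row_le (source d))); exact: evE.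
- apply: ev_and; last exact: evE.
  by apply: evC (ev_good b c (source d) (target d) lN); exact: evE.
- by rewrite /h; case: ifP => _; exact: evE.
Qed.

Lemma ev_entry0 (v : tree R) : ev N (FE e_entry0) v (enc_entry (entry0 R)).
Proof. by split=> //=; rewrite rmorph0. Qed.

Lemma ev_new free i x L : (i <= N)%N -> (size L <= N)%N ->
  let e := argmax (entry0 R) [seq e <- L | free || (e.2.1 <= x)] in
  ev N (f_new free)
    (VPair (VReal x) (VPair (VPair sc (VPair eD eC))
       (VPair (enc_nat R i) (enc_seq (map (@enc_entry R) L)))))
    (enc_entry (e.1 + reward l b c D i x, (x, (i, x) :: e.2.2))).
Proof.
move=> iN LN e; set V := VPair (VReal x) _.
apply: (@evC _ _ (VPair (enc_entry e) (VPair (VReal (reward l b c D i x)) V))); last exact: evE.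
apply: evP; last first.
  by apply: evP; [apply: evC (ev_reward x iN); exact: evE|exact: evE].
apply: (@ev_max _ _ _ (@enc_data R)).
- apply: (@ev_filter _ _ _ (@enc_entry R) predT (fun e => free || (e.2.1 <= x))).
  + exact: evE.
  + exact: LN.
  + by rewrite all_predT.
  + by move=> a _; case: (free); exact: evE.
- exact: ev_entry0.
- by rewrite size_filter (leq_trans (count_size _ _)).
Qed.

Lemma ev_step free i L : (i <= N)%N -> (size L <= N)%N ->
  ev N (f_step free)
    (VPair (VPair sc (VPair eD eC))
       (VPair (enc_nat R i) (enc_seq (map (@enc_entry R) L))))
    (enc_seq (map (@enc_entry R) (dp_step (on_side l b) free C (reward l b c D) i L))).
Proof.
move=> iN LN; apply: evI; first by apply: evC (ev_side b c lN iN); exact: evE.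
rewrite /dp_step; case: ifP => _.
  rewrite -map_comp; apply: (@ev_map _ _ _ _ (@VReal R) (@enc_entry R) predT).
  - exact: evE.
  - by case/andP: CN.
  - by rewrite all_predT.
  - by move=> x _; exact: ev_new.
apply: (@evC _ _ (enc_entry (argmax (entry0 R) L))).
  by apply: (@ev_max _ _ _ (@enc_data R)); [exact: evE|exact: ev_entry0|].
by split=> //=; rewrite rmorph0.
Qed.

(** The list of entries stays within [N]: a row leaves one entry per candidate, or a single
    entry. *)
Lemma ev_dp free d : all (fun i => i <= N)%N d -> (size d <= N)%N ->
  ev N (f_dp free)
    (VPair (VPair sc (VPair eD eC)) (enc_seq (map (enc_nat R) (rev d))))
    (enc_seq (map (@enc_entry R) (dp (on_side l b) free C (reward l b c D) d))).
Proof.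
move=> dN sN; rewrite /dp -foldl_rev.
apply: (@evL _ _ _ _ (enc_nat R) (fun L => enc_seq (map (@enc_entry R) L))
  (fun i => i <= N)%N (fun L => size L <= N)%N).
- exact: evE.
- by split=> //=; rewrite rmorph0.
- by rewrite size_rev.
- by rewrite all_rev.
- by case/andP: CN => /= C0 /(leq_trans C0).
move=> i L iN LN; split.
  by apply: evC (ev_step free iN LN); exact: evE.
case/andP: CN => C0 CN'; rewrite /dp_step; case: ifP => _; rewrite ?size_map //=.
exact: leq_trans CN'.
Qed.

End Instance.

Lemma map_e_nat (v : tree R) n : teval (fun=> v) (e_nat n) = enc_nat R n.
Proof. by elim: n => //= n ->. Qed.

Lemma ev_cols (v : tree R) : ev N (FE (e_cols w)) v (enc_seq (map (enc_nat R) (iota 0 w))).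
Proof. by split=> //=; rewrite /e_cols; elim: (iota 0 w) => //= n s ->; rewrite map_e_nat. Qed.

Variable B : seq (driver R (grid m w)).
Hypotheses (BN : (2 * size B <= N)%N) (B1N : (size B < N)%N) (sN : (m * (2 * w) <= N)%N)
  (m0 : (0 < m)%N) (w0 : (0 < w)%N).

Let eD : tree R := enc_seq (map (@enc_driver R m w) (orient B)).
Let eC : tree R := enc_seq (map (@VReal R) (cands B)).
Let eS : tree R := VPair eD (VPair eC (VPair (enc_seq (map (enc_nat R) (iota 0 m)))
   (enc_seq (map (enc_nat R) (rev (iota 0 m)))))).

Lemma ev_scenario q : (q.1 <= N)%N ->
  let e := scenario B q in
  ev N (f_scenario (1 < w)%N) (VPair (enc_scenario R q) eS)
    (VPair (VReal e.1) (enc_sol e.2)).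
Proof.
case: q => [l [b c]] /= lN; set L := dp _ _ _ _ _.
apply: (@evC _ _ (VPair (enc_entry (argmax (entry0 R) L)) (VPair (enc_scenario R (l, (b, c))) eS))); last exact: evE.
apply: evP; last exact: evE.
have DN : (size (orient B) <= N)%N.
  by rewrite /orient size_cat size_rev size_map addnn -mul2n.
have CN : (0 < size (cands B) <= N)%N by rewrite /= size_map.
apply: (@ev_max _ _ _ (@enc_data R)).
- apply: evC (ev_dp b c lN DN CN (1 < w)%N _ _); last 2 first.
  + by rewrite /L; apply/allP => i; rewrite mem_stack => im; exact: leq_trans (ltnW im) mN.
  + by rewrite /stack; case: (b); rewrite ?size_rev size_iota.
  apply: evP; first exact: evE.
  apply: (@evI _ _ b); first exact: evE.
  by rewrite /stack; case: (b); rewrite ?revK; exact: evE.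
- exact: ev_entry0.
- rewrite /L /dp; case: (stack b m) => [|i d] /=; first by case/andP: CN => /= C0 /(leq_trans C0).
  by case/andP: CN => C0 CN'; rewrite /dp_step; case: ifP => _; rewrite ?size_map //= (leq_trans C0).
Qed.

Lemma ev_best : ev N (f_best w) eS (VPair (VReal (best B).1) (enc_sol (best B).2)).
Proof.
have lsz : size (scenarios m w) = (m * (2 * w))%N.
  by rewrite /scenarios !size_allpairs !size_iota.
apply: (@ev_max _ _ _ (@enc_sol R)); last by rewrite size_map lsz.
  have w2 : (2 * w <= N)%N by apply: leq_trans sN; rewrite leq_pmull.
  rewrite -map_comp; apply: (@ev_map _ _ _ _ (enc_scenario R)
    (fun e : R * (nat * seq (nat * R)) => VPair (VReal e.1) (enc_sol e.2)) (fun q => q.1 <= N)%N).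
  - apply: (@ev_pairs _ _ _ _ (enc_nat R)
      (fun bc : bool * nat => VPair (enc_bool bc.1) (enc_nat R bc.2))).
    + exact: evE.
    + apply: (@ev_pairs _ _ _ _ enc_bool (enc_nat R)).
      * exact: evE.
      * exact: ev_cols.
      * by rewrite (leq_trans _ w2) // leq_pmulr.
      * by rewrite size_iota.
      * by rewrite size_iota.
    + by rewrite size_iota.
    + by rewrite size_allpairs size_iota.
    + by rewrite size_allpairs !size_iota.
  - by rewrite lsz.
  - by apply/allP => _ /allpairsP[[l bc] /= [+ _ ->]]; rewrite mem_iota => /andP[_ lm];
      exact: leq_trans (ltnW lm) mN.
  - by move=> q qN; exact: ev_scenario.
by split=> //=; rewrite rmorph0.
Qed.

End Programs.

(** * The complete program *)

Definition f_lookup : fn :=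
  FL (FE (EFst arg)) (FE (EReal 0))
     (FI (FC f_eq (FE (EPair (ESnd 'cx) (EFst 'hd))))
         (FE (EAdd 'ac (ESnd 'hd))) (FE 'ac)).

Definition f_pot : fn :=
  FI (FC f_eq (FE (EPair (ESnd (EFst arg)) (EFst (ESnd arg)))))
     (FC f_lookup (FE (EPair (ESnd (ESnd arg)) (EFst (EFst arg)))))
     (FE (EReal 0)).

Definition f_dist : fn :=
  FI (FE (ELe (EFst arg) (ESnd arg))) (FE (ESub (ESnd arg) (EFst arg)))
     (FE (ESub (EFst arg) (ESnd arg))).

Definition f_next : fn :=
  let x := EFst (EFst arg) in
  let y := ESnd (EFst arg) in
  let eq a b := FC f_eq (FE (EPair a b)) in
  f_or (f_and (eq (EFst y) (EFst x)) (eq (ESnd y) (EPair ENil (ESnd x))))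
       (f_and (eq (EFst y) (EPair ENil (EFst x))) (eq (ESnd y) (ESnd x))).

(** The argument is (best candidate, rows). Edges are produced in the order of [grid_edges]. *)
Definition f_output (w : nat) : fn :=
  let V := f_pairs (FE (ESnd arg)) (FE (e_cols w)) in
  let sol := ESnd (EFst (ESnd arg)) in
  f_map (f_filter (f_pairs V V) f_next)
    (FP (FE (EFst arg))
        (FC f_dist (FP (FC f_pot (FE (EPair (EFst (EFst arg)) sol)))
                       (FC f_pot (FE (EPair (ESnd (EFst arg)) sol)))))).

Definition f_orient : fn :=
  FL (FE (ESnd arg)) (FE (ESnd arg))
     (FE (EPair (EPair (EPair (ESnd (EFst 'hd)) (EFst (EFst 'hd))) (ESnd 'hd)) 'ac)).

Definition f_cands : fn :=
  FC (FE (EPair (EReal 0) arg)) (f_map (FE (ESnd arg)) (FE (ESnd 'hd))).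

(** Counting upwards and pushing each number lists the rows in decreasing order. *)
Definition f_desc : fn :=
  FC (FE (ESnd arg))
     (FL (FE (EFst arg)) (FE (EPair ENil ENil))
         (FE (EPair (EPair ENil (EFst 'ac)) 'ac))).

Definition f_main (w : nat) : fn :=
  FC (f_output w)
     (FP (FC (f_best w) (FP f_orient (FP f_cands (FP (FC f_rev f_desc) f_desc))))
         (FC f_rev f_desc)).

(** The recorded prices are folded over by [f_lookup], so their number has to be bounded. *)
Lemma dp_size (R : realType) (priced : pred nat) free (C : seq R) rw d e :
  e \in dp priced free C rw d -> (size e.2.2 <= size d)%N.
Proof.
elim: d e => [|i d IH] e /=; first by rewrite inE => /eqP ->.
have H L : {subset L <= dp priced free C rw d} ->
    (size (argmax (entry0 R) L).2.2 <= size d)%N.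
  by move=> sL; have := argmax_mem (entry0 R) L; rewrite inE => /orP[/eqP ->//|/sL/IH].
rewrite /dp_step; case: ifP => _; last by rewrite inE => /eqP -> /=; apply/ltnW/H.
by move=> /mapP[x _ ->] /=; apply: H => e'; rewrite mem_filter => /andP[].
Qed.

Lemma best_size (R : realType) m w (B : seq (driver R (grid m w))) :
  (size (best B).2.2 <= m)%N.
Proof.
have := argmax_mem (0, (0%N, [::])) (map (scenario B) (scenarios m w)).
rewrite -/(best B) inE => /orP[/eqP ->//|/mapP[[l [b c]] _ ->]] /=.
set L := dp _ _ _ _ _; have := argmax_mem (entry0 R) L; rewrite inE => /orP[/eqP ->//|/dp_size].
by rewrite /stack; case: (b); rewrite ?size_rev size_iota.
Qed.

(** * Correctness of the complete program *)

Section Main.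
Variables (R : realType) (N m w : nat).
Hypotheses (mN : (m <= N)%N) (wN : (w <= N)%N).

Lemma ev_lookup (t : seq (nat * R)) i : (size t <= N)%N -> (i <= N)%N ->
  ev N f_lookup (VPair (enc_wit t) (enc_nat R i)) (VReal (lookup t i)).
Proof.
move=> tN iN; pose h (a : R) (e : nat * R) := if i == e.1 then a + e.2 else a.
have -> : lookup t i = foldl h 0 t.
  suff H s a : foldl h a s = a + lookup s i by rewrite H add0r.
  rewrite /lookup; elim: s a => [|e s IH] a; first by rewrite big_nil addr0.
  by rewrite big_cons /= IH /h eq_sym; case: ifP => // _; rewrite addrA.
apply: (@evL _ _ _ _ (fun e : nat * R => VPair (enc_nat R e.1) (VReal e.2))
  (@VReal R) predT predT).
- exact: evE.
- by split=> //=; rewrite rmorph0.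
- exact: tN.
- by rewrite all_predT.
- by [].
move=> e a _ _; split=> //; apply: evI.
  by apply: evC (ev_eq _ e.1 iN); exact: evE.
by rewrite /h; case: ifP => _; exact: evE.
Qed.

Lemma ev_pot c t (x : grid m w) : (size t <= N)%N ->
  ev N f_pot (VPair (enc_vertex R x) (enc_sol (c, t))) (VReal (col_pot c (lookup t) x)).
Proof.
move=> tN; apply: evI; first by apply: evC (ev_eq _ c (col_le wN x)); exact: evE.
rewrite /col_pot; case: ifP => _; last by split=> //=; rewrite rmorph0.
by apply: evC (ev_lookup tN (row_le mN x)); exact: evE.
Qed.

Lemma ev_dist (a b : R) : ev N f_dist (VPair (VReal a) (VReal b)) (VReal `|a - b|).
Proof.
apply: (@evI _ _ (a <= b)); first exact: evE.
case: (leP a b) => [ab|/ltW ab]; first by rewrite distrC ger0_norm ?subr_ge0 //; exact: evE.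
by rewrite ger0_norm ?subr_ge0 //; exact: evE.
Qed.

Lemma ev_next (x y : grid m w) v :
  ev N f_next (VPair (VPair (enc_vertex R x) (enc_vertex R y)) v) (enc_bool (grid_next x y)).
Proof.
rewrite /grid_next -[y.1 == x.1](inj_eq val_inj) -[y.2 == x.2](inj_eq val_inj) /=.
apply: ev_or; apply: ev_and.
- by apply: evC (ev_eq _ _ (row_le mN y)); exact: evE.
- by apply: evC (ev_eq _ x.2.+1 (col_le wN y)); exact: evE.
- by apply: evC (ev_eq _ x.1.+1 (row_le mN y)); exact: evE.
- by apply: evC (ev_eq _ _ (col_le wN y)); exact: evE.
Qed.

Lemma ev_output c t (z : R) : (size t <= N)%N -> ((m * w) ^ 2 <= N)%N ->
  (0 < m)%N -> (0 < w)%N ->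
  ev N (f_output w)
    (VPair (VPair (VReal z) (enc_sol (c, t))) (enc_seq (map (enc_nat R) (iota 0 m))))
    (enc_pricing (pot_pricing (@col_pot R m w c (lookup t)))).
Proof.
move=> tN mwN m0 w0; set v := VPair _ _.
have vsz : size (grid_vertices m w) = (m * w)%N.
  by rewrite size_allpairs !size_enum_ord.
have mw : (m * w <= N)%N.
  by apply: leq_trans mwN; rewrite expnS expn1 leq_pmulr // muln_gt0 m0.
have eV : ev N (f_pairs (FE (ESnd arg)) (FE (e_cols w))) v
    (enc_seq (map (@enc_vertex R m w) (grid_vertices m w))).
  apply: (@ev_pairs _ _ _ _ (fun i : 'I_m => enc_nat R i) (fun j : 'I_w => enc_nat R j));
    rewrite ?size_enum_ord //.
    by rewrite (map_comp (enc_nat R) val) val_enum_ord; exact: evE.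
  by rewrite (map_comp (enc_nat R) val) val_enum_ord; exact: ev_cols.
have -> : enc_pricing (pot_pricing (@col_pot R m w c (lookup t))) =
  enc_seq [seq VPair (VPair (enc_vertex R xy.1) (enc_vertex R xy.2))
               (VReal `|col_pot c (lookup t) xy.1 - col_pot c (lookup t) xy.2|)
          | xy <- grid_edges m w].
  by congr enc_seq; apply: eq_map => xy /=; rewrite pot_costE.
pose F := @col_pot R m w c (lookup t).
pose encE (xy : grid m w * grid m w) := VPair (enc_vertex R xy.1) (enc_vertex R xy.2).
apply: (@ev_map _ _ _ (tree R) encE id predT
  (fun xy => VPair (encE xy) (VReal `|F xy.1 - F xy.2|))).
- apply: (@ev_filter _ _ _ encE predT (fun xy => grid_next xy.1 xy.2)).
  + by apply: (ev_pairs eV eV); rewrite vsz // mulnn.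
  + by rewrite size_allpairs vsz mulnn.
  + by rewrite all_predT.
  + by move=> [x y] _; exact: ev_next.
- by rewrite size_filter (leq_trans (count_size _ _)) // size_allpairs vsz mulnn.
- by rewrite all_predT.
move=> [x y] _; apply: evP; first exact: evE.
apply: evC (ev_dist _ _); apply: evP.
  by apply: evC (ev_pot c x tN); exact: evE.
by apply: evC (ev_pot c y tN); exact: evE.
Qed.

Variable B : seq (driver R (grid m w)).
Hypotheses (BN : (2 * size B <= N)%N) (B1N : (size B < N)%N)
  (mw2N : ((m * w) ^ 2 <= N)%N) (sN : (m * (2 * w) <= N)%N)
  (m0 : (0 < m)%N) (w0 : (0 < w)%N).

Lemma ev_orient :
  ev N f_orient (enc_instance B) (enc_seq (map (@enc_driver R m w) (orient B))).
Proof.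
have -> : orient B = foldl (fun s d => flip d :: s) B B.
  suff H (s acc : seq (driver R (grid m w))) :
      foldl (fun s d => flip d :: s) acc s = rev (map (@flip R _) s) ++ acc.
    by rewrite H.
  by elim: s acc => //= d s IH acc; rewrite IH rev_cons cat_rcons.
apply: (@evL _ _ _ _ (@enc_driver R m w)
  (fun s => enc_seq (map (@enc_driver R m w) s)) predT predT).
- exact: evE.
- exact: evE.
- exact: ltnW.
- by rewrite all_predT.
- by [].
- by move=> d s _ _; split=> //; exact: evE.
Qed.

Lemma ev_cands : ev N f_cands (enc_instance B) (enc_seq (map (@VReal R) (cands B))).
Proof.
apply: (@evC _ _ (enc_seq [seq VReal (budget d) | d <- B])).
  apply: (@ev_map _ _ _ _ (@enc_driver R m w) (@VReal R) predT).
  - exact: evE.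
  - exact: ltnW.
  - by rewrite all_predT.
  - by move=> d _; exact: evE.
by split=> //=; rewrite rmorph0 -map_comp.
Qed.

Lemma ev_desc : ev N f_desc (enc_instance B) (enc_seq (map (enc_nat R) (rev (iota 0 m)))).
Proof.
pose h (t : nat * seq nat) (_ : unit) := (t.1.+1, t.1 :: t.2).
pose encT (t : nat * seq nat) := VPair (enc_nat R t.1) (enc_seq (map (enc_nat R) t.2)).
have hE : foldl h (0%N, [::]) (nseq m tt) = (m, rev (iota 0 m)).
  suff H k a s : foldl h (a, s) (nseq k tt) = (a + k, rev (iota a k) ++ s)%N by rewrite H cats0.
  elim: k a s => [|k IH] a s /=; first by rewrite addn0.
  by rewrite IH addSnnS rev_cons cat_rcons.
apply: (@evC _ _ (encT (m, rev (iota 0 m)))); last exact: evE.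
rewrite -hE; apply: (@evL _ _ _ _ (fun=> VNil) encT predT predT).
- by rewrite -enc_natE; exact: evE.
- exact: evE.
- by rewrite size_nseq.
- by rewrite all_predT.
- by [].
- by move=> u [a s] _ _; split=> //; exact: evE.
Qed.

Lemma ev_main : ev N (f_main w) (enc_instance B) (enc_pricing (best_pricing B)).
Proof.
have asc : ev N (FC f_rev f_desc) (enc_instance B) (enc_seq (map (enc_nat R) (iota 0 m))).
  apply: evC ev_desc _; have := @ev_rev R N (map (enc_nat R) (rev (iota 0 m))).
  by rewrite -map_rev revK size_map size_rev size_iota; apply.
have szN : (size (best B).2.2 <= N)%N by exact: leq_trans (best_size B) mN.
apply: evC (evP _ asc) (_ : ev N (f_output w) (VPair (VPair (VReal (best B).1) (enc_sol (best B).2)) _) _).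
  apply: evC (ev_best mN wN BN B1N sN m0 w0).
  by apply: evP ev_orient (evP ev_cands (evP asc ev_desc)).
rewrite /best_pricing; move: szN; case: (best B) => [z [c t]] /= szN.
exact: ev_output.
Qed.

End Main.

(** * Polynomial running time and the theorem *)

Lemma size_enc_seq (R : Type) (s : seq (tree R)) : (size s < val_size (enc_seq s))%N.
Proof. by elim: s => //= a s IH; lia. Qed.

Theorem theorem1 (w : nat) (hw : (1 <= w)%N) :
  exists (algo : cmd) (a k C : nat),
    forall (R : realType) (m : nat) (hm : (1 <= m)%N)
        (B : seq (driver R (grid m w))),
      exists (p : pricing R (grid m w)) (t : nat),
        [/\ runs algo (enc_instance B) t (enc_pricing p),
            (t <= a * val_size (enc_instance B) ^ k)%N
          & OPT B <= C%:R * ln (m.+1)%:R * revenue p B].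
Proof.
have [a [k cost_le]] := cost_poly (f_main w).
(* The time bound a N^k at N = (4 w S)^2 equals a (4 w)^(2k) S^(2k), with [S] the size of the
   instance; the ratio is that of [OPT_le]. *)
exists (compile (f_main w) 0), (a * (4 * w) ^ (2 * k))%N, (2 * k)%N, (16 * w ^ 2)%N => R m hm B.
(* [S] exceeds both m and the number of drivers, so [N] bounds every list of the run: scenarios,
   oriented drivers and the (m w)^2 pairs of vertices included. *)
pose S := val_size (enc_instance B); pose N := ((4 * w * S) ^ 2)%N.
have mS : (m < S)%N.
  rewrite /S /=; have := size_enc_seq (nseq m (@VNil R)); rewrite size_nseq /enc_nat; lia.
have BS : (size B < S)%N.
  rewrite /S /=; have := size_enc_seq [seq enc_driver d | d <- B]; rewrite size_map; lia.
have wS : (w * S <= w * S * (w * S))%N by rewrite leq_pmulr // muln_gt0 hw; lia.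
have SwS : (S <= w * S)%N by rewrite leq_pmull.
have mwS : (m * w <= w * S)%N by rewrite mulnC leq_mul2l ltnW ?orbT.
have NE : N = (16 * (w * S * (w * S)))%N by rewrite /N expnS expn1; lia.
have [evE_ sf] : ev N (f_main w) (enc_instance B) (enc_pricing (best_pricing B)).
  have mw2 : ((m * w) ^ 2 <= w * S * (w * S))%N by rewrite -mulnn leq_mul.
  have mw : (m * (2 * w) <= 2 * (w * S))%N by rewrite mulnCA leq_mul2l mwS orbT.
  have ww : (w <= w * S)%N by rewrite leq_pmulr //; lia.
  by apply: ev_main => //; rewrite NE; lia.
have [t [s [ex so _ tl]]] := compileP sf (erefl : update (fun=> VNil) 0 (enc_instance B) 0 = _).
exists (best_pricing B), t; split; last exact: OPT_le.
  by exists s => //; rewrite so.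
apply: leq_trans tl (leq_trans (cost_le N _) _).
  by rewrite NE; lia.
by rewrite /N -/S -expnM expnMn mulnA.
Qed.
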